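(* Let $G$ be an abelian group, let $n\geq 1$, and let $S\in \mathcal F(G)$ be a sequence with $|S|>n$. Let $m=\min\{n,\,|S|-n,\,|S|-\mathsf h(S)\}$ and suppose $|\Sigma_n(S)|\leq m+1$. Then one of the following holds, where Items 1–4 are only possible if $|\Sigma_n(S)|=m+1$ or $|\mathrm{supp}(S)|=1$: 1. $n=2$, $|S|=|\mathrm{supp}(S)|$, and $\mathrm{supp}(S)=x+K$ for some subgroup $K\leq G$ and $x\in G$ with $K\cong (\mathbb Z/2\mathbb Z)^2$. 2. $m=2$ and $\mathrm{supp}(S)=x+K$ for some subgroup $K\leq G$ and $x\in G$ with $K\cong \mathbb Z/3\mathbb Z$. 3. $|\mathrm{supp}(S)|\leq 2$. 4. $\mathrm{supp}(S)\subseteq \{x-d,x,x+d\}$ for some $x,d\in G$ with $\mathsf v_x(S)=\mathsf h(S)\geq |S|-m$. 5. There exist $x\in G$ and a setpartition $\mathscr A=A_1\cdot\ldots\cdot A_n$ with $\mathsf S(\mathscr A)\mid S$, $|\mathsf S(\mathscr A)|=n+m$, $\sum_{i=1}^{n}A_i=\Sigma_n(S)$, $\mathrm{supp}(\mathsf S(\mathscr A)^{[-1]}\cdot S)\subseteq x+H$, $|A_i|\leq 2$ and $(x+H)\cap A_i\neq \emptyset$ for all $i\in [1,n]$, and $|\sum_{i=1}^{n}A_i|=|\sum_{i\in[1,n],\,i\neq j}A_i|$ for some $j\in [1,n]$, where $H=\mathsf H(\Sigma_n(S))$ is nontrivial.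
   Context: A sequence $S$ over $G$ is a finite unordered list of elements of $G$ (element of the free abelian monoid $\mathcal F(G)$, operation $\cdot$); $|S|$ its length, $\mathsf v_g(S)$ the multiplicity of $g$, $\mathsf h(S)=\max_g\mathsf v_g(S)$, $\mathrm{supp}(S)$ the set of elements occurring, $T\mid S$ means subsequence, $T^{[-1]}\cdot S$ is $S$ with the terms of $T$ removed, $\sigma(T)$ the sum of terms, $\Sigma_n(S)=\{\sigma(T):T\mid S,|T|=n\}$. $\mathsf H(A)=\{g:g+A=A\}$. Sumsets $A_1+\dots+A_n=\{a_1+\dots+a_n:a_i\in A_i\}$. A setpartition is a sequence $\mathscr A=A_1\cdot\ldots\cdot A_n$ of finite nonempty subsets of $G$; $\mathsf S(\mathscr A)$ is the sequence of all elements of all $A_i$ (counted once per set containing it). *)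

(* Defs.v *)
From HB Require Import structures.
From mathcomp Require Import all_boot all_order all_algebra.
From mathcomp Require Import finmap.
Set Implicit Arguments. Unset Strict Implicit. Unset Printing Implicit Defensive.
Import GRing.Theory.
Local Open Scope ring_scope.
Local Open Scope fset_scope.

Section Defs.
Variable G : zmodType.

Definition hmax (S : seq G) : nat := \max_(g <- S) count_mem g S.

Definition supp (S : seq G) : {fset G} := [fset g in S].

(* T | S : T is a subsequence of S in the free abelian monoid F(G) *)
Definition mdivides (T S : seq G) : Prop := forall g, (count_mem g T <= count_mem g S)%N.

Definition mremove (T S : seq G) : seq G := foldl (fun s t => rem t s) S T.

Definition Sigma (n : nat) (S : seq G) : {fset G} :=
  [fset (\sum_(z <- mask (val t) S) z)%R | t : (size S).-tuple bool & count id t == n].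

Definition sumset (A B : {fset G}) : {fset G} := [fset (a + b)%R | a in A, b in B].

Definition bigsumset (I : Type) (r : seq I) (P : pred I) (A : I -> {fset G}) : {fset G} :=
  \big[sumset/[fset (0 : G)]]_(i <- r | P i) A i.

Definition in_stab (A : {fset G}) (g : G) : Prop := [fset (g + a)%R | a in A] = A.

Definition translate (x : G) (A : {fset G}) : {fset G} := [fset (x + a)%R | a in A].

Definition seq_of_part (n : nat) (A : 'I_n -> {fset G}) : seq G :=
  flatten [seq enum_fset (A i) | i <- enum 'I_n].

End Defs.

Definition mpar (G : zmodType) (n : nat) (S : seq G) : nat :=
  minn n (minn (size S - n) (size S - hmax S)).

(* Main.v *)
(** Let m = mpar n S. Write S as m pairs of distinct terms, n - m singletons, and unused
    terms. The sumset of these n sets lies in Sigma n S and is a translate of the set D of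
    subset sums of the m differences. Adding one more difference d enlarges a set of subset
    sums unless d stabilizes it; so Kneser's bound |D| >= |H| (1 + #{d outside H}), with
    H = stab D, is elementary.

    Take a decomposition with |D| maximal. If at least |H| differences lie in H, choose it,
    moreover, with as many differences outside H as possible, and let K be a smallest
    subgroup containing at least |K| differences: any |K| - 1 of these already sum to K, so
    each such pair is redundant, and its terms can be exchanged with the other terms of S
    without losing any sum. Maximality forces all other sets and all unused terms to meet
    one H-coset, which is Item 5; the only way out is Item 1. If instead some difference is
    redundant but H contains fewer than |H| of them, then D = H and all of S lies in one
    H-coset. If no difference is redundant, then |D| = m + 1 and any two differences d, d'
    satisfy |{0,d} + {0,d'}| = 3, that is d' = d or d' = -d; exchanging terms once more
    confines S to x - d, x, x + d. *)
Require Import Defs.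
From HB Require Import structures.
From mathcomp Require Import all_boot all_order all_algebra.
From mathcomp Require Import finmap zify.
From Stdlib Require Import Classical.
Set Implicit Arguments.
Unset Strict Implicit.
Unset Printing Implicit Defensive.
Import GRing.Theory.
Local Open Scope fset_scope.
Local Open Scope ring_scope.

(** * Identities in abelian groups *)

Inductive zexp :=
  | ZVar of nat
  | ZZero
  | ZAdd of zexp & zexp
  | ZOpp of zexp.

Fixpoint zeval (G : zmodType) (env : seq G) (e : zexp) : G :=
  match e with
  | ZVar i => nth 0 env i
  | ZZero => 0
  | ZAdd e1 e2 => zeval env e1 + zeval env e2
  | ZOpp e1 => - zeval env e1
  end.

(* The lists of positive and of negative occurrences of the atoms. *)
Fixpoint znorm (e : zexp) : seq nat * seq nat :=
  match e with
  | ZVar i => ([:: i], [::])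
  | ZZero => ([::], [::])
  | ZAdd e1 e2 => ((znorm e1).1 ++ (znorm e2).1, (znorm e1).2 ++ (znorm e2).2)
  | ZOpp e1 => ((znorm e1).2, (znorm e1).1)
  end.

Lemma znormP (G : zmodType) (env : seq G) e :
  zeval env e =
  \sum_(i <- (znorm e).1) nth 0 env i - \sum_(i <- (znorm e).2) nth 0 env i.
Proof.
elim: e => [i||e1 IH1 e2 IH2|e IH] /=.
- by rewrite big_seq1 big_nil subr0.
- by rewrite !big_nil subr0.
- by rewrite IH1 IH2 !big_cat /= opprD addrACA.
- by rewrite IH opprB.
Qed.

(** Moving the negative occurrences to the other side leaves two multisets of atoms to compare;
    [perm_eq] decides this, so [zmod] closes its goal by computation. *)
Lemma zmod_correct (G : zmodType) (env : seq G) e1 e2 :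
  perm_eq ((znorm e1).1 ++ (znorm e2).2) ((znorm e2).1 ++ (znorm e1).2) ->
  zeval env e1 = zeval env e2.
Proof.
move=> p; rewrite !znormP; apply/eqP; rewrite subr_eq addrAC eq_sym subr_eq.
by rewrite -!big_cat /= eq_sym; apply/eqP; rewrite (perm_big _ p).
Qed.

Ltac zmod_index x l :=
  match l with
  | x :: _ => constr:(O)
  (* This case identifies atoms that are convertible but spelled differently. *)
  | ?y :: _ => let e := constr:(erefl x : x = y) in constr:(O)
  | _ :: ?l' => let i := zmod_index x l' in constr:(S i)
  end.
Ltac zmod_atoms l t :=
  match t with
  | @GRing.add _ ?a ?b => let l' := zmod_atoms l a in zmod_atoms l' b
  | @GRing.opp _ ?a => zmod_atoms l a
  | @GRing.zero _ => l
  | _ => match l with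
         | _ => let i := zmod_index t l in l
         | _ => constr:(t :: l)
         end
  end.
Ltac zmod_reify l t :=
  match t with
  | @GRing.add _ ?a ?b =>
      let u := zmod_reify l a in let v := zmod_reify l b in constr:(ZAdd u v)
  | @GRing.opp _ ?a => let u := zmod_reify l a in constr:(ZOpp u)
  | @GRing.zero _ => constr:(ZZero)
  | _ => let i := zmod_index t l in constr:(ZVar i)
  end.
Ltac zmod :=
  match goal with
  | |- @eq ?T ?a ?b =>
      let l := zmod_atoms (@nil T) a in
      let l := zmod_atoms l b in
      let u := zmod_reify l a in
      let v := zmod_reify l b in
      exact (@zmod_correct _ l u v isT)
  end.

(** Uses one equation as a hypothesis: the second premise says that x - y = a - b, an identity that
    [zmod] can check. *)
Lemma zmod_shift (G : zmodType) (a b x y : G) : a = b -> x + b = y + a -> x = y.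
Proof. by move=> -> /addIr. Qed.

Ltac zmod_from h :=
  first [apply: (zmod_shift h); zmod
        |apply: (zmod_shift (esym h)); zmod].

(* [simpl] makes the two spellings of the carrier of [#|` A|] agree. *)
Ltac fslia := simpl in *; lia.

(** * Sumsets and stabilizers *)

Section Sumsets.
Variable G : zmodType.
Implicit Types (A B C X Y Z K : {fset G}) (g x y z d : G) (ds : seq G).

Lemma in_sumset A B z :
  reflect (exists x y, [/\ x \in A, y \in B & z = x + y]) (z \in sumset A B).
Proof.
apply: (iffP (imfset2P _ _ _ _ _)).
  by move=> [x xA [y yB ->]]; exists x, y.
by move=> [x [y [xA yB ->]]]; exists x => //; exists y.
Qed.

Lemma mem_sumset A B x y : x \in A -> y \in B -> x + y \in sumset A B.
Proof. by move=> xA yB; apply/in_sumset; exists x, y. Qed.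

Lemma sumsetC : commutative (@sumset G).
Proof.
by move=> A B; apply/fsetP=> z; apply/in_sumset/in_sumset => -[x [y [xA yB ->]]];
  exists y, x; rewrite addrC.
Qed.

Lemma sumsetA : associative (@sumset G).
Proof.
move=> A B C; apply/fsetP=> z; apply/in_sumset/in_sumset.
  move=> [x [_ [xA /in_sumset [y [t [yB tC ->]]] ->]]].
  by exists (x + y), t; rewrite addrA mem_sumset.
move=> [_ [t [/in_sumset [x [y [xA yB ->]]] tC ->]]].
by exists x, (y + t); rewrite addrA mem_sumset.
Qed.

Lemma sumset0 : left_id [fset 0] (@sumset G).
Proof.
move=> A; apply/fsetP=> z; apply/in_sumset/idP.
  by move=> [x [y [/fset1P -> yA ->]]]; rewrite add0r.
by move=> zA; exists 0, z; rewrite fset11 add0r.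
Qed.

(** With this instance, iterated sumsets can be permuted and split by the general lemmas on big
    operators. *)
HB.instance Definition _ :=
  Monoid.isComLaw.Build {fset G} [fset 0] (@sumset G) sumsetA sumsetC sumset0.

Lemma translateE g A : translate g A = sumset [fset g] A.
Proof.
apply/fsetP=> z; apply/imfsetP/in_sumset.
  by move=> [x xA ->]; exists g, x; rewrite fset11.
by move=> [_ [y [/fset1P -> yA ->]]]; exists y.
Qed.

Lemma in_translate g A z : (z \in translate g A) = (z - g \in A).
Proof.
rewrite translateE; apply/in_sumset/idP.
  by move=> [_ [y [/fset1P -> yA ->]]]; rewrite addrC addKr.
by move=> zA; exists g, (z - g); split; [exact: fset11| |zmod].
Qed.

Lemma card_translate g A : #|` translate g A| = #|` A|.
Proof. by rewrite card_imfset //; apply: addrI. Qed.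

Lemma translate0 A : translate 0 A = A.
Proof. by rewrite translateE sumset0. Qed.

Lemma translateD g h A : translate (g + h) A = translate g (translate h A).
Proof. by apply/fsetP=> z; rewrite !in_translate opprD addrA. Qed.

Lemma translate_inj g : injective (translate g).
Proof.
by move=> A B e; rewrite -[A]translate0 -[B]translate0 -(addNr g) !translateD e.
Qed.

Lemma translate_sumset g A B : translate g (sumset A B) = sumset (translate g A) B.
Proof. by rewrite !translateE sumsetA. Qed.

Lemma translate_sumsetr g A B : translate g (sumset A B) = sumset A (translate g B).
Proof. by rewrite sumsetC translate_sumset sumsetC. Qed.

Lemma sumsetUl A B C : sumset (A `|` B) C = sumset A C `|` sumset B C.
Proof.
apply/fsetP=> z; rewrite in_fsetU; apply/in_sumset/orP.
  move=> [x [y [+ yC ->]]]; rewrite in_fsetU => /orP [xA|xB]; [left|right];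
  exact: mem_sumset.
by move=> [|] /in_sumset [x [y [xA yC ->]]]; exists x, y; rewrite in_fsetU xA ?orbT.
Qed.

Lemma sumset_pair a b A : sumset [fset a; b] A = translate a A `|` translate b A.
Proof. by rewrite sumsetUl !translateE. Qed.

Lemma sumsetS A B C : A `<=` B -> sumset C A `<=` sumset C B.
Proof.
move=> /fsubsetP sAB; apply/fsubsetP=> _ /in_sumset [x [y [xC yA ->]]].
by rewrite mem_sumset ?sAB.
Qed.

(** A period of a nonempty [X] is a difference of two elements of [X], so the stabilizer can be cut
    out of this finite set. For empty [X] the result is empty, whence the side condition of
    [in_stabE]. *)
Definition stab X : {fset G} :=
  [fset g in [fset x - y | x in X, y in X] | translate g X == X].

Lemma in_stabE X g : X != fset0 -> (g \in stab X) = (translate g X == X).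
Proof.
move=> /fset0Pn [x xX]; rewrite !inE /=; apply: andb_idl => /eqP e.
apply/imfset2P; exists (g + x); first by rewrite -e in_translate addrC addKr.
by exists x => //; rewrite addrK.
Qed.

Lemma stabP X g : g \in stab X -> translate g X = X.
Proof. by rewrite !inE => /andP [_ /eqP]. Qed.

Definition subgrp K := 0 \in K /\ forall x y, x \in K -> y \in K -> x - y \in K.

Lemma subgrpN {K} : subgrp K -> forall x, (- x \in K) = (x \in K).
Proof.
move=> [K0 KB]; have h x : x \in K -> - x \in K.
  by move=> xK; rewrite -[- x]add0r KB.
by move=> x; apply/idP/idP => /h //; rewrite opprK.
Qed.

Lemma subgrpD {K} : subgrp K -> forall x y, x \in K -> y \in K -> x + y \in K.
Proof.
by move=> hK x y xK yK; rewrite -[y]opprK; apply: hK.2 => //; rewrite subgrpN.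
Qed.

Lemma subgrpDr {K} : subgrp K -> forall x y, x \in K -> (y + x \in K) = (y \in K).
Proof.
move=> hK x y xK; apply/idP/idP => [h|yK]; last exact: subgrpD.
by rewrite -(addrK x y) hK.2.
Qed.

Lemma translateS g A B : A `<=` B -> translate g A `<=` translate g B.
Proof. by move=> s; rewrite !translateE sumsetS. Qed.

Lemma translate_opp g X : translate g X = X -> translate (- g) X = X.
Proof. by move=> e; rewrite -{1}e -translateD addNr translate0. Qed.

Lemma stab_subgrp X : X != fset0 -> subgrp (stab X).
Proof.
move=> X0; split; first by rewrite in_stabE // translate0.
move=> x y xX yX; rewrite in_stabE // translateD.
by rewrite (translate_opp (stabP yX)) (stabP xX).
Qed.

(** With [period_sumset], passes between two forms of periodicity: invariance under each translation
    by [K], and K + X = X, a form that is inherited by larger sumsets. *)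
Lemma sumset_period K X :
  K != fset0 -> (forall g, g \in K -> translate g X = X) -> sumset K X = X.
Proof.
move=> /fset0Pn [k kK] h; apply/fsetP=> z; apply/in_sumset/idP.
  move=> [g [x [gK xX ->]]]; rewrite -(h _ gK) in_translate addrC addKr //.
by move=> zX; exists k, (z - k); split; [|rewrite -in_translate h|zmod].
Qed.

Lemma period_sumset {K X} : subgrp K -> sumset K X = X ->
  forall g, g \in K -> translate g X = X.
Proof.
move=> hK e g gK; rewrite -e translate_sumset; congr sumset.
by apply/fsetP=> z; rewrite in_translate subgrpDr // subgrpN.
Qed.

Lemma stab_translate g X : X != fset0 -> stab (translate g X) = stab X.
Proof.
move=> X0; apply/fsetP=> h; rewrite !in_stabE //; last first.
  by rewrite -cardfs_eq0 card_translate cardfs_eq0.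
by rewrite -translateD addrC translateD (inj_eq (@translate_inj g)).
Qed.

Lemma translate_subset_eq g X Y : translate g X `<=` Y -> (#|` Y| <= #|` X|)%N ->
  translate g X = Y.
Proof. by move=> s c; apply/eqP; rewrite eqEfcard s card_translate. Qed.

End Sumsets.

(** * Subset sums *)

Section SubsetSums.
Variable G : zmodType.
Implicit Types (A B C X Y Z K L : {fset G}) (g x y z d e : G) (ds es ks : seq G).

Definition subsums ds : {fset G} := \big[@sumset G/[fset 0]]_(d <- ds) [fset 0; d].

Lemma subsums_cons d ds :
  subsums (d :: ds) = subsums ds `|` translate d (subsums ds).
Proof. by rewrite /subsums big_cons sumset_pair translate0. Qed.

Lemma subsums_cat ds es : subsums (ds ++ es) = sumset (subsums ds) (subsums es).
Proof. by rewrite /subsums big_cat. Qed.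

Lemma subsums_perm ds es : perm_eq ds es -> subsums ds = subsums es.
Proof. by move=> p; rewrite /subsums (perm_big _ p). Qed.

Lemma subsums0 ds : 0 \in subsums ds.
Proof.
elim: ds => [|d ds IH]; first by rewrite /subsums big_nil fset11.
by rewrite subsums_cons in_fsetU IH.
Qed.

Lemma subsums_neq0 ds : subsums ds != fset0.
Proof. by apply/fset0Pn; exists 0; apply: subsums0. Qed.

Lemma subsums_cons_stab d ds :
  translate d (subsums ds) = subsums ds -> subsums (d :: ds) = subsums ds.
Proof. by move=> e; rewrite subsums_cons e fsetUid. Qed.

Lemma subsums_cons_lt d ds :
  translate d (subsums ds) != subsums ds -> (#|` subsums ds| < #|` subsums (d :: ds)|)%N.
Proof.
move=> ne; apply: fproper_ltn_card; rewrite fproperEneq subsums_cons fsubsetUl andbT.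
apply: contra ne => /eqP e; rewrite eqEfcard card_translate leqnn andbT.
by rewrite {2}e fsubsetUr.
Qed.

Definition redundant ds :=
  exists d es, perm_eq ds (d :: es) /\ translate d (subsums es) = subsums es.

Lemma redundant_perm ds es : perm_eq ds es -> redundant ds -> redundant es.
Proof.
move=> p [d [fs [q st]]]; exists d, fs; split=> //.
by apply: perm_trans q; rewrite perm_sym.
Qed.

Lemma redundant_cons d ds : redundant ds -> redundant (d :: ds).
Proof.
move=> [e [es [p st]]]; exists e, (d :: es); split.
  apply: (@perm_trans _ (d :: e :: es)); first by rewrite perm_cons.
  by apply/permP=> a /=; lia.
by rewrite -[d :: es]/([:: d] ++ es) subsums_cat translate_sumsetr st.
Qed.

(** Without redundancy, no difference of [ds] is a period of the sums formed after it, so each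
    enlarges the set by at least one element. *)
Lemma card_subsums_cat ds es : ~ redundant (ds ++ es) ->
  (#|` subsums es| + size ds <= #|` subsums (ds ++ es)|)%N.
Proof.
elim: ds => [|d ds IH] nr; first by rewrite addn0.
rewrite /= addnS; apply: leq_trans (@subsums_cons_lt d (ds ++ es) _).
  by rewrite ltnS IH // => r; apply: nr; apply: redundant_cons.
by apply/eqP=> e; apply: nr; exists d, (ds ++ es); rewrite perm_refl.
Qed.

Lemma subsums_nil : subsums [::] = [fset 0].
Proof. by rewrite /subsums big_nil. Qed.

Lemma card_subsums ds : ~ redundant ds -> (size ds < #|` subsums ds|)%N.
Proof.
move=> nr; have := @card_subsums_cat ds [::].
by rewrite cats0 subsums_nil cardfs1 add1n; apply.
Qed.

(** All partial sumsets are unions of cosets of [K], so every difference that enlarges one adds at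
    least a whole coset. *)
Lemma card_sumset_subsums K B ds : subgrp K -> B != fset0 -> sumset K B = B ->
  (forall d, d \in ds ->
     translate d (sumset B (subsums ds)) <> sumset B (subsums ds)) ->
  (#|` B| + #|` K| * size ds <= #|` sumset B (subsums ds)|)%N.
Proof.
move=> hK B0 KB; elim: ds => [|d ds IH] ns.
  by rewrite subsums_nil (sumsetC B) sumset0 muln0 addn0.
have BE : sumset B (subsums (d :: ds)) =
    sumset B (subsums ds) `|` translate d (sumset B (subsums ds)).
  by rewrite subsums_cons sumsetC sumsetUl -translate_sumset !(sumsetC _ B).
(* A period of the smaller sumset is a period of the larger one, so the hypothesis on the full list
   passes to its tail. *)
have ns' e : e \in d :: ds ->
    translate e (sumset B (subsums ds)) <> sumset B (subsums ds).
  move=> eds st; apply: (ns e eds).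
  rewrite -[d :: ds]/([:: d] ++ ds) subsums_cat sumsetA (sumsetC B) -sumsetA.
  by rewrite translate_sumsetr st.
have {}IH := IH (fun e eds => ns' e (mem_behead (s := d :: ds) eds)).
rewrite BE; set Z := sumset B (subsums ds) in BE IH ns' *.
have KZ : sumset K Z = Z by rewrite sumsetA KB.
have /fsubsetPn [z zd zZ] : ~~ (translate d Z `<=` Z).
  apply: contra_notN (ns' d (mem_head _ _)) => s; apply/eqP.
  by rewrite eqEfcard s card_translate leqnn.
(* With [z], its whole coset is new, because [Z] is periodic under [K]. *)
have KzZ : translate z K `<=` (Z `|` translate d Z) `\` Z.
  apply/fsubsetP=> y; rewrite in_translate => yK.
  have st : translate (y - z) Z = Z by apply: (period_sumset hK KZ).
  rewrite in_fsetD in_fsetU; apply/andP; split.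
    by rewrite -st in_translate (_ : y - (y - z) = z) //; zmod.
  apply/orP; right; rewrite in_translate -st in_translate.
  rewrite (_ : y - d - (y - z) = z - d); last by zmod.
  by rewrite -in_translate.
have := fsubset_leq_card KzZ; rewrite card_translate cardfsDS ?fsubsetUl //.
have := fsubset_leq_card (fsubsetUl Z (translate d Z)).
by rewrite mulnS; move: IH; set a := (_ * _)%N; fslia.
Qed.

Lemma subsums_sub K ds : subgrp K -> all (fun d => d \in K) ds -> subsums ds `<=` K.
Proof.
move=> hK; elim: ds => [|d ds IH] /=.
  by rewrite subsums_nil => _; apply/fsubsetP=> z /fset1P ->; apply: hK.1.
move=> /andP [dK /IH /fsubsetP s]; rewrite subsums_cons; apply/fsubsetP=> z.
rewrite in_fsetU in_translate => /orP [/s //|/s].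
by rewrite subgrpDr // subgrpN.
Qed.

Lemma sumset_subgrp_absorb K A : subgrp K -> A != fset0 -> A `<=` K -> sumset K A = K.
Proof.
move=> hK /fset0Pn [a aA] /fsubsetP s; apply/fsetP=> z; apply/in_sumset/idP.
  by move=> [x [y [xK /s yK ->]]]; apply: subgrpD.
move=> zK; exists (z - a), a; split=> //; last by zmod.
by apply: hK.2 => //; apply: s.
Qed.

Lemma subgrp_neq0 K : subgrp K -> K != fset0.
Proof. by move=> hK; apply/fset0Pn; exists 0; apply: hK.1. Qed.

Lemma sumset_subgrp K : subgrp K -> sumset K K = K.
Proof. by move=> hK; rewrite sumset_subgrp_absorb ?subgrp_neq0 ?fsubset_refl. Qed.

(* Kneser's theorem for a sumset of two-element sets. *)
Lemma card_subsums_stab ds :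
  (#|` stab (subsums ds)| * (count (fun d => d \notin stab (subsums ds)) ds).+1
   <= #|` subsums ds|)%N.
Proof.
set D := subsums ds; set H := stab D.
have D0 : D != fset0 := subsums_neq0 ds.
have hH : subgrp H := stab_subgrp D0.
have H0 : H != fset0 := subgrp_neq0 hH.
have HD : sumset H D = D by apply: sumset_period => // g /stabP.
(* The differences in [H] are absorbed by [H], so [D] is [H] plus the subset sums of [dsN]; no
   element of [dsN] is a period of [D]. *)
pose dsN := [seq d <- ds | d \notin H]; pose dsH := [seq d <- ds | d \in H].
have DE : D = sumset H (subsums dsN).
  have dH : sumset H (subsums dsH) = H.
    rewrite sumset_subgrp_absorb ?subsums_neq0 //.
    by apply: subsums_sub => //; apply: filter_all.
  rewrite -[X in sumset X _]dH -sumsetA -subsums_cat.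
  by rewrite (@subsums_perm _ ds) // perm_filterC.
have := @card_sumset_subsums H H dsN hH H0.
rewrite sumset_subgrp_absorb // -DE size_filter mulnS; apply=> // d.
rewrite mem_filter => /andP [dH _] st; move: dH.
by rewrite in_stabE // st eqxx.
Qed.

Lemma min_subgrp L ds : subgrp L -> (#|` L| <= count (fun d => d \in L) ds)%N ->
  exists K, [/\ subgrp K, (#|` K| <= count (fun d => d \in K) ds)%N &
    forall L', subgrp L' -> (#|` L'| <= count (fun d => d \in L') ds)%N ->
      (#|` K| <= #|` L'|)%N].
Proof.
elim: {L}_.+1 {-2}L (ltnSn #|` L|) => // n IH L Ln hL cL.
case: (classic (exists L', [/\ subgrp L',
  (#|` L'| <= count (fun d => d \in L') ds)%N & (#|` L'| < #|` L|)%N])).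
  by move=> [L' [hL' cL' lt]]; apply: (IH L') => //; fslia.
move=> nex; exists L; split=> // L' hL' cL'; rewrite leqNgt; apply/negP=> lt.
by apply: nex; exists L'.
Qed.

(* Minimality of [K] leaves no proper nontrivial subgroup [L] with [|L|] differences, so
   the Kneser bound for [stab (subsums ks)] forces the whole of [K]. *)
Lemma subsums_min_subgrp K ds ks es : subgrp K ->
  (forall L', subgrp L' -> (#|` L'| <= count (fun d => d \in L') ds)%N ->
     (#|` K| <= #|` L'|)%N) ->
  perm_eq ds (ks ++ es) -> all (fun d => d \in K) ks ->
  (#|` K|.-1 <= size ks)%N -> subsums ks = K.
Proof.
move=> hK Kmin p ksK sz.
have s := subsums_sub hK ksK.
set L := stab (subsums ks); have D0 := subsums_neq0 ks.
have hL : subgrp L := stab_subgrp D0.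
have Lperiod g : g \in L -> translate g (subsums ks) = subsums ks by move/stabP.
have LK : L `<=` K.
  apply/fsubsetP=> g /Lperiod st; apply: (fsubsetP s).
  by rewrite -st in_translate subrr subsums0.
have kn := card_subsums_stab ks; rewrite -/L in kn.
have cE := count_predC (fun d => d \in L) ks.
have cle := fsubset_leq_card s; have cLK := fsubset_leq_card LK.
have Lpos : (0 < #|` L|)%N by rewrite cardfs_gt0; apply/fset0Pn; exists 0; apply: hL.1.
set cH := count _ ks in cE; set cN := count (fun d => d \notin L) ks in kn.
have {}cE : (cH + cN = size ks)%N by [].
case: (leqP #|` L| cH) => [cL|cL].
  have cds : (cH <= count (fun d => d \in L) ds)%N.
    by move/permP: p => ->; rewrite count_cat leq_addr.
  have LE : L = K by apply/eqP; rewrite eqEfcard LK /= Kmin // (leq_trans cL).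
  apply/eqP; rewrite eqEfsubset s; apply/fsubsetP=> g; rewrite -LE => gL.
  by rewrite -(Lperiod g gL) in_translate subrr subsums0.
(* Now fewer than |L| of the [ks] lie in [L], so |L| (cN + 1) >= |L| + cN >= size ks + 1 >= |K|. *)
apply/eqP; rewrite eqEfcard s /=.
apply: leq_trans kn; rewrite mulnS; apply: (@leq_trans (#|` L| + cN)); first by fslia.
by rewrite leq_add2l leq_pmull.
Qed.

(** The members of [es] in [K] already sum to all of [K]. Hence the sums stay periodic after the
    removal of [r]. *)
Lemma subsums_min_subgrp_stab K ds r es g : subgrp K ->
  (forall L', subgrp L' -> (#|` L'| <= count (fun d => d \in L') ds)%N ->
     (#|` K| <= #|` L'|)%N) ->
  perm_eq ds (r ++ es) -> (#|` K|.-1 <= count (fun d => d \in K) es)%N ->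
  g \in K -> translate g (subsums es) = subsums es.
Proof.
move=> hK Kmin p c gK; pose ks := [seq d <- es | d \in K].
have pf : perm_eq es (ks ++ [seq d <- es | d \notin K]) by rewrite perm_sym perm_filterC.
have kE : subsums ks = K.
  apply: (@subsums_min_subgrp K ds ks (r ++ [seq d <- es | d \notin K])) => //.
  - by apply/permP=> a; rewrite (permP p) !count_cat (permP pf) count_cat; lia.
  - exact: filter_all.
  - by rewrite size_filter.
rewrite (subsums_perm pf) subsums_cat kE; apply: (period_sumset hK _ gK).
by rewrite sumsetA sumset_subgrp.
Qed.

End SubsetSums.

(** * Decomposing a sequence into pairs, singletons and unused terms *)

Definition diff (G : zmodType) (p : G * G) : G := p.2 - p.1.
Notation diffs := (map (@diff _)).

Section Decompositions.
Variable G : zmodType.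
Implicit Types (S T R bs ys : seq G) (ps qs : seq (G * G)) (x y z a b : G).

(** This and [SigmaE] replace the masks in the definition of [Sigma] by splittings of [S] up to
    permutation. *)
Lemma SigmaI n S T R : perm_eq S (T ++ R) -> size T = n -> \sum_(t <- T) t \in Sigma n S.
Proof.
move=> p sT.
have /count_subseqP [T' /subseqP [mk smk T'E] TT'] : forall x, (count_mem x T <= count_mem x S)%N.
  by move=> x; move/permP: p => ->; rewrite count_cat leq_addr.
apply/imfsetP; exists (Tuple (introT eqP smk)) => /=.
  by rewrite inE /= -(size_mask smk) -T'E -(perm_size TT') sT.
by rewrite -T'E (perm_big _ TT').
Qed.

Lemma perm_mask_cat (T : eqType) (mk : bitseq) (s : seq T) : size mk = size s ->
  perm_eq s (mask mk s ++ mask (map negb mk) s).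
Proof.
elim: s mk => [|u s IH] [|[] mk] //= [/IH h]; first by rewrite perm_cons.
by rewrite (perm_trans _ (_ : perm_eq (u :: (mask mk s ++ mask (map negb mk) s)) _)) ?perm_cons //;
   apply/permP=> a /=; rewrite !count_cat /=; fslia.
Qed.

Lemma SigmaE n S z : z \in Sigma n S ->
  exists T R, [/\ perm_eq S (T ++ R), size T = n & z = \sum_(t <- T) t].
Proof.
move=> /imfsetP [mk /= + ->]; rewrite inE => /eqP c.
exists (mask mk S), (mask (map negb mk) S).
by rewrite perm_mask_cat ?size_tuple // size_mask ?size_tuple.
Qed.

Fixpoint flatp ps : seq G :=
  if ps is p :: ps' then [:: p.1, p.2 & flatp ps'] else [::].

Lemma flatpE ps : flatp ps = flatten [seq [:: p.1; p.2] | p <- ps].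
Proof. by elim: ps => //= p ps ->. Qed.

Lemma flatp_perm ps qs : perm_eq ps qs -> perm_eq (flatp ps) (flatp qs).
Proof. by move=> p; rewrite !flatpE; apply: perm_flatten; apply: perm_map. Qed.

Lemma size_flatp ps : size (flatp ps) = (size ps).*2.
Proof. by elim: ps => //= p ps ->. Qed.

(** Adding the difference of a pair or not means selecting its second or its first term; [R]
    collects the terms left over. *)
Lemma subsums_diffs_choice ps z : z \in subsums (diffs ps) ->
  exists T R, [/\ perm_eq (flatp ps) (T ++ R), size T = size ps &
    \sum_(p <- ps) p.1 + z = \sum_(t <- T) t].
Proof.
elim: ps z => [|[a b] ps IH] z /=; rewrite /diff /=.
  by rewrite subsums_nil => /fset1P ->; exists [::], [::]; rewrite !big_nil addr0.
rewrite subsums_cons in_fsetU in_translate.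
move=> /orP [] /IH [T [R [p sT e]]].
  exists (a :: T), (b :: R); split=> /=; [|by rewrite sT|].
    by move/permP: p => p; apply/permP=> c; have := p c; rewrite /= !count_cat /=; fslia.
  by rewrite !big_cons -e /=; zmod.
exists (b :: T), (a :: R); split=> /=; [|by rewrite sT|].
  by move/permP: p => p; apply/permP=> c; have := p c; rewrite /= !count_cat /=; fslia.
by rewrite !big_cons -e /=; zmod.
Qed.

Lemma Sigma_pairs n S ps T R z :
  perm_eq S (flatp ps ++ T ++ R) -> (size ps + size T)%N = n ->
  z \in subsums (diffs ps) ->
  \sum_(p <- ps) p.1 + \sum_(t <- T) t + z \in Sigma n S.
Proof.
move=> p sz /subsums_diffs_choice [T' [R' [p' sT' e]]].
rewrite addrAC e -big_cat /=; apply: (@SigmaI _ _ _ (R' ++ R)).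
  by apply/permP=> c; rewrite (permP p) !count_cat (permP p') !count_cat; fslia.
by rewrite size_cat sT'.
Qed.

Definition decomp (n m : nat) S ps bs ys :=
  [/\ perm_eq S (flatp ps ++ bs ++ ys), all (fun p => p.1 != p.2) ps,
      size ps = m & size bs = (n - m)%N].

(** The sum of one particular selection: the first term of each pair and all singletons. The other
    selections differ from it by subset sums of the differences. *)
Definition base ps bs : G := \sum_(p <- ps) p.1 + \sum_(b <- bs) b.

Lemma decomp_perm n m S ps qs bs ys :
  perm_eq ps qs -> decomp n m S ps bs ys -> decomp n m S qs bs ys.
Proof.
move=> p [pS ne sz sb]; split=> //.
- by apply: perm_trans pS _; rewrite perm_cat2r flatp_perm.
- by rewrite -(perm_all _ p).
- by rewrite -(perm_size p).
Qed.

Lemma base_perm ps qs bs : perm_eq ps qs -> base ps bs = base qs bs.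
Proof. by move=> p; rewrite /base (perm_big _ p). Qed.

Lemma decomp_sub n m S ps bs ys : (m <= n)%N -> decomp n m S ps bs ys ->
  translate (base ps bs) (subsums (diffs ps)) `<=` Sigma n S.
Proof.
move=> mn [pS _ sz sb]; apply/fsubsetP=> z; rewrite in_translate => zD.
rewrite (_ : z = base ps bs + (z - base ps bs)); last by zmod.
by apply: (Sigma_pairs pS) => //; rewrite sz sb subnKC.
Qed.

Lemma card_decomp_le n m S ps bs ys : (m <= n)%N -> decomp n m S ps bs ys ->
  (#|` subsums (diffs ps)| <= #|` Sigma n S|)%N.
Proof.
move=> mn d; rewrite -(card_translate (base ps bs)).
exact: fsubset_leq_card (decomp_sub mn d).
Qed.

Lemma count_le_hmax S g : (count_mem g S <= hmax S)%N.
Proof.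
case: (boolP (g \in S)) => [gS|/count_memPn -> //].
by rewrite /hmax (big_rem g) //= leq_maxl.
Qed.

(** Induction on [m]. Two distinct leftover terms form a new pair. If all leftover terms equal [x],
    a pair {u, v} avoiding [x] is replaced by {u, x} and {v, x}. *)
Lemma pairs_exist S m : (m.*2 <= size S)%N -> (m + hmax S <= size S)%N ->
  exists ps R, [/\ perm_eq S (flatp ps ++ R), all (fun p => p.1 != p.2) ps & size ps = m].
Proof.
elim: m => [|m IH] m2 mh; first by exists [::], S.
have [||ps [R [p ne sz]]] := IH; [fslia|fslia|].
have sR : (1 < size R)%N.
  have := perm_size p; rewrite size_cat size_flatp sz; fslia.
case: R p sR => [//|x R] p sR.
case: (boolP (all (pred1 x) R)) => [/all_pred1P RE|/allPn [y yR yx]]; last first.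
  exists ((x, y) :: ps), (rem y R); split; last by rewrite /= sz.
    apply/permP=> c; rewrite (permP p) /= !count_cat /= (permP (perm_to_rem yR)) /=; fslia.
  by rewrite /= ne andbT eq_sym.
case: (boolP (has (fun p => (p.1 != x) && (p.2 != x)) ps)) => [/hasP [[u v] /= uv]|].
  move=> /andP [ux vx]; move: p sR; rewrite RE; case: (size R) => [//|r] p _.
  have [qs pr] : exists qs, perm_eq ps ((u, v) :: qs).
    by exists (rem (u, v) ps); apply: perm_to_rem.
  exists [:: (u, x), (v, x) & qs], (nseq r x); split.
  - apply/permP=> c; rewrite (permP p) /= !count_cat /= (permP (flatp_perm pr)) /=. fslia.
  - by move: ne; rewrite /= ux vx (perm_all _ pr) /= => /andP [].
  - by rewrite -sz (perm_size pr).
move=> /hasPn hx.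
(* Every pair contains [x], so [x] occurs at least m + (|S| - 2m) = |S| - m times, more than
   [hmax S] allows. *)
have cx : (m <= count_mem x (flatp ps))%N.
  rewrite -sz; elim: ps hx {IH p ne sz} => [//|[u v] ps IH hx].
  have /IH h : {in ps, forall p, ~~ ((p.1 != x) && (p.2 != x))}.
    by move=> q qps; apply: hx; rewrite inE qps orbT.
  have := hx (u, v); rewrite inE eqxx => /(_ isT) /=.
  by rewrite /= negb_and !negbK; case: (u == x); case: (v == x); fslia.
have := count_le_hmax S x; rewrite (permP p) count_cat /= eqxx RE count_nseq /= eqxx.
have := perm_size p; rewrite size_cat size_flatp sz /=; fslia.
Qed.

(** Each term of the minimum [mpar] has its use: m <= n and m <= |S| - n give 2m <= |S| and leave n
    - m terms for the singletons, and m <= |S| - h(S) makes the pairs possible. *)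
Lemma decomp_exists n S : (n < size S)%N ->
  exists ps bs ys, decomp n (mpar n S) S ps bs ys.
Proof.
move=> nS; have hS : (hmax S <= size S)%N.
  by rewrite /hmax; elim/big_ind: _ => // [x y|g _]; rewrite ?geq_max ?count_size => // -> ->.
have [||ps [R [p ne sz]]] := @pairs_exist S (mpar n S); rewrite /mpar; [fslia|fslia|].
exists ps, (take (n - mpar n S) R), (drop (n - mpar n S) R); split=> //.
  by rewrite cat_take_drop.
rewrite size_take; have := perm_size p; rewrite size_cat size_flatp sz /mpar.
by case: ifP => //; fslia.
Qed.

(** Both terms are completed by the same n - 1 others. This transfers a coset containing [Sigma n S]
    to the terms of [S]. *)
Lemma Sigma_swap n S a b : (0 < n)%N -> (n < size S)%N -> a \in S -> b \in S ->
  a = b \/ exists z, z + a \in Sigma n S /\ z + b \in Sigma n S.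
Proof.
case: n => // n _ nS aS bS; case: (eqVneq a b) => [->|ab]; [by left|right].
have pa := perm_to_rem aS; have bR : b \in rem a S by rewrite rem_mem // eq_sym.
have pb := perm_to_rem bR; set R := rem b _ in pb.
have p : perm_eq S [:: a, b & R] by apply: perm_trans pa _; rewrite perm_cons.
have st : size (take n R) = n.
  by rewrite size_take; have := perm_size p; rewrite /=; case: ifP => //; fslia.
exists (\sum_(t <- take n R) t); split; rewrite addrC.
  rewrite (_ : _ + _ = \sum_(t <- a :: take n R) t); last (by rewrite big_cons); apply: (@SigmaI _ _ _ (b :: drop n R)).
    apply: perm_trans p _; apply/permP=> c.
    by rewrite -{1}(cat_take_drop n R) /= !count_cat /=; fslia.
  by rewrite /= st.
rewrite (_ : _ + _ = \sum_(t <- b :: take n R) t); last (by rewrite big_cons); apply: (@SigmaI _ _ _ (a :: drop n R)).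
  apply: perm_trans p _; apply/permP=> c.
  by rewrite -{1}(cat_take_drop n R) /= !count_cat /=; fslia.
by rewrite /= st.
Qed.

End Decompositions.

(** * Building a setpartition from a decomposition *)

Section Structured.
Variable G : zmodType.
Implicit Types (S T R bs ys : seq G) (ps qs : seq (G * G)) (x y z a b : G) (H : {fset G}).

Lemma Sigma_perm n S T : perm_eq S T -> Sigma n S = Sigma n T.
Proof.
move=> p; apply/fsetP=> z; apply/idP/idP => /SigmaE [U [R [q sU ->]]]; apply: SigmaI sU.
  by apply: perm_trans q; rewrite perm_sym.
exact: perm_trans p q.
Qed.

Lemma sum_shift T x : \sum_(t <- T) t = \sum_(t <- T) (t - x) + x *+ size T.
Proof.
elim: T => [|t T IH]; first by rewrite !big_nil addr0.
by rewrite !big_cons IH mulrS; zmod.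
Qed.

Definition meets x H p := (p.1 - x \in H) || (p.2 - x \in H).

(** Modulo [H], one term of each pair vanishes after centring at [x]. So selecting none, one or both
    terms of a pair contributes the same as some choice of exactly one. *)
Lemma mask_flatp_mem H x ps mk : subgrp H -> all (meets x H) ps ->
  \sum_(t <- mask mk (flatp ps)) (t - x) - \sum_(p <- ps) (p.1 - x)
    \in sumset H (subsums (diffs ps)).
Proof.
move=> hH; elim: ps mk => [|[a b] ps IH] mk /=.
  move=> _; rewrite mask0 !big_nil subr0 subsums_nil sumsetC sumset0; exact: hH.1.
rewrite {1}/meets /= => /andP [ab /IH {}IH].
(* Masks that are too short are padded with [false], so that exactly four cases remain for the first
   pair. *)
have E0 mk' : exists m1 m2 mk2,
    mask mk' [:: a, b & flatp ps] = mask [:: m1, m2 & mk2] [:: a, b & flatp ps].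
  case: mk' => [|m1 [|m2 mk2]]; last by exists m1, m2, mk2.
    by exists false, false, [::]; rewrite /= !mask0s.
  by exists m1, false, [::]; rewrite /= !mask0s.
have [m1 [m2 [mk2 ->]]] := E0 mk.
rewrite subsums_cons /diff /= sumsetC sumsetUl -translate_sumset !(sumsetC _ H).
have := IH mk2; set E := sumset H _; set u := _ - _ => uE.
have Eh h w : h \in H -> w = u + h -> w \in E.
  have HE : sumset H E = E.
    by rewrite /E sumsetA sumset_subgrp.
  by move=> hh ->; rewrite -(period_sumset hH HE hh) in_translate addrK.
have H0 := hH.1; have Hn y : y \in H -> - y \in H by rewrite subgrpN.
rewrite in_fsetU in_translate big_cons /=; apply/orP.
case/orP: ab => h; move: m1 m2 => [] []; rewrite /= ?big_cons.
- by right; apply: (Eh _ _ h); rewrite /u; zmod.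
- by left; apply: (Eh _ _ H0); rewrite /u; zmod.
- by right; apply: (Eh _ _ H0); rewrite /u; zmod.
- by left; apply: (Eh _ _ (Hn _ h)); rewrite /u; zmod.
- by left; apply: (Eh _ _ h); rewrite /u; zmod.
- by left; apply: (Eh _ _ H0); rewrite /u; zmod.
- by right; apply: (Eh _ _ H0); rewrite /u; zmod.
- by right; apply: (Eh _ _ (Hn _ h)); rewrite /u; zmod.
Qed.

Lemma mask_sum_mem H x W mk : subgrp H -> all (fun w => w - x \in H) W ->
  \sum_(t <- mask mk W) (t - x) \in H.
Proof.
move=> hH /allP hW; rewrite big_seq.
by elim/big_ind: _ => [|u v|u /mem_mask /hW //]; [exact: hH.1|exact: subgrpD].
Qed.

(** Modulo [H], unpaired terms equal [x] and each pair acts as a single choice, so no selection of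
    [n] terms leaves the translate of the subset sums. *)
Lemma Sigma_structured n m S ps bs ys x : (m <= n)%N -> decomp n m S ps bs ys ->
  let H := stab (subsums (diffs ps)) in
  all (meets x H) ps -> all (fun w => w - x \in H) (bs ++ ys) ->
  translate (base ps bs) (subsums (diffs ps)) = Sigma n S.
Proof.
move=> mn dec H hps hW; have [pS ne sz sb] := dec.
have D0 := subsums_neq0 (diffs ps); have hH : subgrp H := stab_subgrp D0.
apply/eqP; rewrite eqEfsubset (decomp_sub mn dec); apply/fsubsetP=> z.
rewrite (Sigma_perm _ pS) => /imfsetP [mk /= + ->]; rewrite inE => /eqP cn.
have sT : size (mask mk (flatp ps ++ bs ++ ys)) = n by rewrite size_mask ?size_tuple.
(* Everything is centred at [x]; the selection and [base] both have [n] terms, so the multiples of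
   [x] cancel. *)
rewrite in_translate (sum_shift _ x) sT.
have [mk1 [mk2 mkE]] : exists mk1 mk2, mask mk (flatp ps ++ bs ++ ys) =
    mask mk1 (flatp ps) ++ mask mk2 (bs ++ ys).
  exists (take (size (flatp ps)) mk), (drop (size (flatp ps)) mk).
  rewrite -mask_cat ?cat_take_drop // size_take size_tuple size_cat.
  by case: ifP => //; lia.
rewrite mkE big_cat /=; have := mask_flatp_mem mk1 hH hps.
rewrite sumset_period; last 2 first.
- exact: subgrp_neq0.
- by move=> g /stabP.
set u := _ - _ => uD; have wH := mask_sum_mem mk2 hH hW; set w := \sum_(t <- mask mk2 _) _ in wH.
have bH : \sum_(b <- bs) (b - x) \in H.
  have := mask_sum_mem (nseq (size bs) true) hH (W := bs); rewrite mask_true //; apply.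
  by move: hW; rewrite all_cat => /andP [].
rewrite -(stabP (hH.2 _ _ wH bH)) in_translate /base.
rewrite (sum_shift bs x) sb; set v := \sum_(b <- bs) _.
rewrite (_ : \sum_(p <- ps) p.1 = \sum_(p <- ps) (p.1 - x) + x *+ m); last first.
  by have := sum_shift (map fst ps) x; rewrite !big_map size_map sz.
rewrite -{1}(subnKC mn) mulrnDr.
by rewrite (_ : _ - _ = u) // /u; zmod.
Qed.

End Structured.

Section SetPartition.
Variable G : zmodType.
Implicit Types (S T R bs ys : seq G) (ps qs : seq (G * G)) (x y z a b : G) (H : {fset G}).

(** Item 5, in exactly the form in which the theorem states it. *)
Definition has_periodic_setpartition (n : nat) S : Prop :=
  exists (x : G) (A : 'I_n -> {fset G}),
      (forall i, A i != fset0) /\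
      mdivides (seq_of_part A) S /\
      size (seq_of_part A) = (n + mpar n S)%N /\
      bigsumset (enum 'I_n) predT A = Sigma n S /\
      (forall y, y \in mremove (seq_of_part A) S -> in_stab (Sigma n S) (y - x)) /\
      (forall i, (#|` A i| <= 2)%N /\ exists2 a, a \in A i & in_stab (Sigma n S) (a - x)) /\
      (exists j : 'I_n,
          #|` bigsumset (enum 'I_n) predT A| = #|` bigsumset (enum 'I_n) (fun i => i != j) A|) /\
      (exists g : G, g != 0 /\ in_stab (Sigma n S) g).

Lemma count_mremove T S y : count_mem y (mremove T S) = (count_mem y S - count_mem y T)%N.
Proof.
elim: T S => [|t T IH] S /=; first by rewrite subn0.
by rewrite IH count_mem_rem eq_sym subnDA.
Qed.

Lemma bigsumset_enum n (P : pred 'I_n) (A : 'I_n -> {fset G}) :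
  bigsumset (enum 'I_n) P A = \big[@sumset G/[fset 0]]_(i < n | P i) A i.
Proof. by rewrite /bigsumset big_enum_cond. Qed.

Definition blocks ps bs : seq {fset G} :=
  [seq [fset p.1; p.2] | p <- ps] ++ [seq [fset b] | b <- bs].

Lemma sumset_blocks ps bs :
  \big[@sumset G/[fset 0]]_(X <- blocks ps bs) X =
  translate (base ps bs) (subsums (diffs ps)).
Proof.
rewrite big_cat /= !big_map /base.
have -> : \big[@sumset G/[fset 0]]_(b <- bs) [fset b] = [fset (\sum_(b <- bs) b)].
  elim: bs => [|b bs IH]; first by rewrite !big_nil.
  by rewrite !big_cons IH -translateE /translate imfset_fset1.
rewrite sumsetC -translateE addrC translateD; congr translate.
elim: ps => [|p ps IH]; first by rewrite !big_nil subsums_nil translate0.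
rewrite !big_cons IH /= subsums_cons sumset_pair.
apply/fsetP=> z; rewrite !(in_fsetU, in_translate) /diff.
set s := \sum_(p <- ps) _; congr (_ || _).
  by rewrite (_ : z - (p.1 + s) = z - p.1 - s) //; zmod.
by rewrite (_ : z - (p.1 + s) - _ = z - p.2 - s) //; zmod.
Qed.

(** Distinctness of the terms of a pair keeps both when the pair becomes a set. *)
Lemma perm_blocks ps bs : all (fun p => p.1 != p.2) ps ->
  perm_eq (flatten [seq enum_fset X | X <- blocks ps bs]) (flatp ps ++ bs).
Proof.
move=> ne; rewrite map_cat flatten_cat; apply: perm_cat.
  elim: ps ne => [//|p ps IH] /= /andP [ne /IH h].
  rewrite -[[:: p.1, p.2 & flatp ps]]/([:: p.1; p.2] ++ flatp ps); apply: perm_cat => //.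
  apply: uniq_perm; rewrite ?fset_uniq //= ?inE ?ne //.
  by move=> u; rewrite !inE.
elim: bs => [//|b bs IH] /=; rewrite -[b :: bs]/([:: b] ++ bs); apply: perm_cat => //.
apply: uniq_perm; rewrite ?fset_uniq //.
by move=> u; rewrite !inE.
Qed.

(** The sets are the pairs and the singletons, with the redundant pair [p] first: it is the set that
    may be omitted, and its difference is the nonzero period. *)
Lemma has_periodic_setpartitionI n S p ps bs ys x :
  (mpar n S <= n)%N -> decomp n (mpar n S) S (p :: ps) bs ys ->
  let H := stab (subsums (diffs (p :: ps))) in
  translate (base (p :: ps) bs) (subsums (diffs (p :: ps))) = Sigma n S ->
  all (meets x H) (p :: ps) -> all (fun w => w - x \in H) (bs ++ ys) ->
  translate (diff p) (subsums (diffs ps)) = subsums (diffs ps) ->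
  has_periodic_setpartition n S.
Proof.
move=> mn [pS ne sz sb] H XE hps hW red.
pose As := blocks (p :: ps) bs; pose A (i : 'I_n) := nth fset0 As i.
have sAs : size As = n by rewrite size_cat !size_map sz sb subnKC.
have stabE g : g \in H -> in_stab (Sigma n S) g.
  move=> /stabP gH; rewrite /in_stab -/(translate g _) -XE -translateD addrC.
  by rewrite translateD gH.
have AE : [seq A i | i <- enum 'I_n] = As.
  apply: (@eq_from_nth _ fset0); first by rewrite size_map size_enum_ord sAs.
  move=> i; rewrite size_map size_enum_ord => i_n.
  by rewrite (nth_map (Ordinal i_n)) ?size_enum_ord // /A nth_enum_ord.
have AmemP i : A i \in As by rewrite mem_nth // sAs.
have SE : perm_eq (seq_of_part A) (flatp (p :: ps) ++ bs).
  by rewrite /seq_of_part map_comp AE perm_blocks.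
have bE : \big[@sumset G/[fset 0]]_(i < n) A i = Sigma n S.
  by rewrite -XE -sumset_blocks -/As (big_nth fset0) sAs big_mkord.
exists x, A; split.
  move=> i; have := AmemP i; rewrite mem_cat => /orP [] /mapP [q _ ->].
    by apply/fset0Pn; exists q.1; rewrite !inE eqxx.
  by apply/fset0Pn; exists q; rewrite !inE eqxx.
split.
  by move=> g; rewrite (permP SE) (permP pS) catA (count_cat _ (_ ++ _)) leq_addr.
split; first by rewrite (perm_size SE) size_cat size_flatp sz sb; lia.
split; first by rewrite bigsumset_enum bE.
split.
  move=> y; rewrite -has_pred1 has_count count_mremove (permP SE) (permP pS) catA.
  rewrite (count_cat _ (_ ++ _)) addKn -has_count has_pred1 => yys; apply: stabE.
  by apply: (allP hW); rewrite mem_cat yys orbT.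
split.
  move=> i; have := AmemP i; rewrite mem_cat => /orP [] /mapP [q qp ->]; split.
  - by rewrite cardfs2; case: eqP.
  - have /orP [h|h] := allP hps _ qp.
      by exists q.1; [rewrite !inE eqxx|apply: stabE].
    by exists q.2; [rewrite !inE eqxx orbT|apply: stabE].
  - by rewrite cardfs1.
  - by exists q; [rewrite !inE|apply: stabE; apply: (allP hW); rewrite mem_cat qp].
split.
  have n0 : (0 < n)%N by rewrite -sAs.
  exists (Ordinal n0); rewrite !bigsumset_enum (bigD1 (Ordinal n0)) //=.
  have -> : A (Ordinal n0) = [fset p.1; p.2] by [].
  set Z := \big[_/_]_(i < n | _) _.
  (* Without the first set the sumset is a translate of the sums of [ps], and [diff p] is a period
     of these. *)
  suff ZE : Z = translate (base ps bs) (subsums (diffs ps)).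
    have e : translate (diff p) Z = Z.
      by rewrite ZE -translateD addrC translateD red.
    rewrite sumset_pair (_ : p.2 = p.1 + diff p); last by rewrite /diff; zmod.
    by rewrite translateD e fsetUid card_translate.
  rewrite -sumset_blocks (big_nth fset0).
  case: n n0 sAs @A @Z {bE AE AmemP SE mn pS sz sb XE stabE} => // n n0 sAs A Z.
  rewrite /Z big_mkcond big_ord_recl /= sumset0 big_mkord.
  have -> : size (blocks ps bs) = n by move: sAs; rewrite /As /= => -[].
  by apply: eq_bigr => i _.
exists (diff p); split.
  by rewrite subr_eq0 eq_sym; case/andP: ne.
apply: stabE; rewrite in_stabE ?subsums_neq0 //= subsums_cons_stab //.
by rewrite red.
Qed.
End SetPartition.

(** * Exchanging terms between pairs *)

Section Exchange.
Variable G : zmodType.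
Implicit Types (S T R bs ys : seq G) (ps qs : seq (G * G)) (x y z a b c d : G) (H K : {fset G}).

Lemma decomp_flip n m S a b ps bs ys :
  decomp n m S ((a, b) :: ps) bs ys -> decomp n m S ((b, a) :: ps) bs ys.
Proof.
move=> [p ne sz sb]; split=> //; last by rewrite /= eq_sym.
by apply/permP=> u; rewrite (permP p) /=; lia.
Qed.

Lemma decomp_swap n m S a b ps bs ys w :
  decomp n m S ((a, b) :: ps) bs ys -> w \in bs ++ ys -> a != w ->
  exists bs' ys', decomp n m S ((a, w) :: ps) bs' ys'.
Proof.
move=> [p /= /andP [ab ne] sz sb] + aw; rewrite mem_cat => /orP [] /perm_to_rem pw.
  exists (b :: rem w bs), ys; split=> //=; last by rewrite -sb (perm_size pw).
    by apply/permP=> u; rewrite (permP p) /= !count_cat (permP pw) /= !count_cat; lia.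
  by rewrite aw.
exists bs, (b :: rem w ys); split=> //=; last by rewrite aw.
by apply/permP=> u; rewrite (permP p) /= !count_cat (permP pw) /=; lia.
Qed.

Lemma decomp_exchange n m S a b c d ps bs ys :
  decomp n m S [:: (a, b), (c, d) & ps] bs ys -> a != c -> b != d ->
  decomp n m S [:: (a, c), (b, d) & ps] bs ys.
Proof.
move=> [p /= /and3P [_ _ ne] sz sb] ac bd; split=> //=; last by rewrite ac bd.
by apply/permP=> u; rewrite (permP p) /=; lia.
Qed.

Definition maximal n m S ps := forall ps' bs' ys', decomp n m S ps' bs' ys' ->
  (#|` subsums (diffs ps')| <= #|` subsums (diffs ps)|)%N.

Lemma maximal_card n m S ps qs :
  #|` subsums (diffs ps)| = #|` subsums (diffs qs)| -> maximal n m S ps -> maximal n m S qs.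
Proof. by move=> e mx ps' bs' ys' /mx; rewrite e. Qed.

Lemma subsums_diffs_perm ps qs : perm_eq ps qs -> subsums (diffs ps) = subsums (diffs qs).
Proof. by move=> p; apply: subsums_perm; apply: perm_map. Qed.

(** Item 1, with the subgroup given as the image of an injective additive map. *)
Definition klein_coset n S :=
  [/\ n = 2%N, size S = #|` supp S| &
           exists (x : G) (f : ('Z_2 * 'Z_2)%type -> G),
             [/\ forall u v, f (u + v) = f u + f v, injective f &
                 supp S = [fset (x + f k) | k : ('Z_2 * 'Z_2)%type]]].

Lemma mem_supp S g : (g \in supp S) = (g \in S).
Proof. by rewrite !inE. Qed.

Lemma forall_Z2 (P : 'Z_2 -> Prop) : P 0 -> P 1 -> forall k, P k.
Proof.
move=> P0 P1 [[|[|//]] k].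
  by rewrite (_ : Ordinal k = 0) //; apply: val_inj.
by rewrite (_ : Ordinal k = 1) //; apply: val_inj.
Qed.

(** The differences b - a and c - a are distinct involutions, and d = a + (b - a) + (c - a)
    completes the coset of the group that they generate. *)
Lemma klein_cosetI S a b c d : perm_eq S [:: a; b; c; d] -> a != b -> b - a = d - c ->
  (b - a) + (b - a) = 0 -> (c - a) + (c - a) = 0 -> c != a -> c != b ->
  klein_coset 2 S.
Proof.
set h := b - a => p ab hd hh; set e := c - a => ee ca cb.
have h0 : h != 0 by rewrite subr_eq0 eq_sym.
have e0 : e != 0 by rewrite subr_eq0.
have eh : e != h by rewrite /e /h (inj_eq (addIr _)).
have he0 : h + e != 0.
  apply: contra eh => /eqP q; apply/eqP.
  by rewrite -[e]add0r -hh -addrA q addr0.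
have bE : b = a + h by rewrite /h; zmod.
have cE : c = a + e by rewrite /e; zmod.
have dE : d = a + (h + e) by rewrite hd /e; zmod.
pose f (k : 'Z_2 * 'Z_2) : G := h *+ k.1 + e *+ k.2.
have f00 : f (0, 0) = 0 by rewrite /f addr0.
have f10 : f (1, 0) = h by rewrite /f addr0.
have f01 : f (0, 1) = e by rewrite /f add0r.
have f11 : f (1, 1) = h + e by [].
have fE : forall P : 'Z_2 * 'Z_2 -> Prop,
    P (0, 0) -> P (1, 0) -> P (0, 1) -> P (1, 1) -> forall k, P k.
  by move=> P P0 P1 P2 P3 [u v]; move: u v; apply: forall_Z2; apply: forall_Z2.
have un : uniq [:: 0; h; e; h + e].
  rewrite /= !inE !negb_or ![0 == _]eq_sym h0 e0 he0 [h == e]eq_sym eh /=.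
  by rewrite -{1}[h]addr0 (inj_eq (addrI h)) eq_sym e0 -{1}[e]add0r (inj_eq (addIr e)) eq_sym h0.
have suppE : supp S = [fset (a + f k) | k : ('Z_2 * 'Z_2)%type].
  apply/fsetP=> g; rewrite mem_supp (perm_mem p) bE cE dE; apply/idP/imfsetP.
    rewrite !inE => /or4P [] /eqP ->.
    - by exists (0, 0) => //; rewrite f00 addr0.
    - by exists (1, 0) => //; rewrite f10.
    - by exists (0, 1) => //; rewrite f01.
    - by exists (1, 1) => //; rewrite f11.
  move=> [k _ ->]; move: k; apply: fE; rewrite ?f00 ?f10 ?f01 ?f11 !inE ?addr0 eqxx ?orbT //.
split=> //.
  rewrite /supp card_fseq undup_id // (perm_uniq p) bE cE dE.
  have -> : [:: a; a + h; a + e; a + (h + e)] = [seq a + g | g <- [:: 0; h; e; h + e]].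
    by rewrite /= addr0.
  by rewrite map_inj_uniq //; apply: addrI.
have fD u v : f (u + v) = f u + f v.
  rewrite /f /=.
  have Z2 (g : G) (i j : 'Z_2) : g + g = 0 -> g *+ (i + j)%R = g *+ i + g *+ j.
    move=> gg; move: i j; apply: forall_Z2; apply: forall_Z2; rewrite /= ?add0r ?addr0 //.
  by rewrite !Z2 //; zmod.
exists a, f; split=> // u v uv.
have : f (u - v) = 0 by apply: (addIr (f v)); rewrite -fD subrK add0r.
have inj0 k : f k = 0 -> k = 0.
  move: k; apply: fE; rewrite ?f00 ?f10 ?f01 ?f11 // => q; exfalso.
  - by rewrite q eqxx in h0.
  - by rewrite q eqxx in e0.
  - by rewrite q eqxx in he0.
by move=> /inj0 /eqP; rewrite subr_eq0 => /eqP.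
Qed.

End Exchange.

(** * Decompositions with many differences in the stabilizer *)

Section Clustered.
Variable G : zmodType.
Implicit Types (S T R bs ys : seq G) (ps qs : seq (G * G)) (p q : G * G)
  (x y z a b c d g w : G) (H K : {fset G}).

Definition inside H ps := count (fun d => d \in H) (diffs ps).
Definition outside H ps := count (fun d => d \notin H) (diffs ps).

Lemma inside_outside H ps : (inside H ps + outside H ps = size ps)%N.
Proof.
rewrite -[RHS](size_map (@diff G)) -(count_predC (fun d => d \in H)).
by congr addn; apply: eq_count.
Qed.

Lemma inside_perm H ps qs : perm_eq ps qs -> inside H ps = inside H qs.
Proof. by move=> p; apply/permP; apply: perm_map. Qed.

Lemma outside_perm H ps qs : perm_eq ps qs -> outside H ps = outside H qs.
Proof. by move=> p; apply/permP; apply: perm_map. Qed.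

Lemma perm_two (T : eqType) (s : seq T) (x y : T) : x \in s -> y \in s -> x != y ->
  exists r, perm_eq s [:: x, y & r].
Proof.
move=> xs ys xy; have px := perm_to_rem xs.
have py : y \in rem x s by rewrite rem_mem // eq_sym.
exists (rem y (rem x s)); apply: perm_trans px _.
by rewrite perm_cons perm_to_rem.
Qed.

Lemma diff_neq0 n m S ps bs ys p : decomp n m S ps bs ys -> p \in ps -> diff p != 0.
Proof. by move=> [_ /allP ne _ _] /ne; rewrite /diff subr_eq0 eq_sym. Qed.

Variables (n : nat) (S : seq G).
Let m := mpar n S.
Hypotheses (mn : (m <= n)%N) (small : (#|` Sigma n S| <= m.+1)%N).

(** * Extremal decompositions and a smallest subgroup [K] *)

Section Extremal.
Variables (ps : seq (G * G)) (bs ys : seq G).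
Let D := subsums (diffs ps).
Let H := stab D.
Hypotheses (dec : decomp n m S ps bs ys) (mx : maximal n m S ps).
Hypothesis many : (#|` H| <= inside H ps)%N.
Hypothesis outmax : forall ps' bs' ys', decomp n m S ps' bs' ys' -> maximal n m S ps' ->
  let H' := stab (subsums (diffs ps')) in
  (#|` H'| <= inside H' ps')%N -> (outside H' ps' <= outside H ps)%N.

Variable K : {fset G}.
Hypotheses (hK : subgrp K) (cK : (#|` K| <= inside K ps)%N).
Hypothesis Kmin : forall L', subgrp L' ->
  (#|` L'| <= count (fun d => d \in L') (diffs ps))%N -> (#|` K| <= #|` L'|)%N.

Let D0 : D != fset0 := subsums_neq0 _.
Let hH : subgrp H := stab_subgrp D0.

Lemma K_periodic r qs g : perm_eq ps (r ++ qs) -> (#|` K|.-1 <= inside K qs)%N ->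
  g \in K -> translate g (subsums (diffs qs)) = subsums (diffs qs).
Proof.
move=> p c gK; apply: (@subsums_min_subgrp_stab _ K (diffs ps) (diffs r) _ g) => //.
by rewrite -map_cat perm_map.
Qed.

Lemma K_sub_H : K `<=` H.
Proof.
apply/fsubsetP=> g gK; rewrite in_stabE //; apply/eqP.
by apply: (@K_periodic [::]) => //; apply: leq_trans cK; apply: leq_pred.
Qed.

Let KH g : g \in K -> g \in H. Proof. exact: (fsubsetP K_sub_H). Qed.

(** At least |K| differences lie in [K], so |K| - 1 of them remain without [p]. *)
Lemma K_pair_redundant p qs : diff p \in K -> perm_eq ps (p :: qs) ->
  translate (diff p) (subsums (diffs qs)) = subsums (diffs qs).
Proof.
move=> pK pp; apply: (@K_periodic [:: p] qs) => //.
by move: cK; rewrite (inside_perm _ pp) /inside /= pK; case: #|` K|.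
Qed.

Lemma card_H_gt1 p : p \in ps -> diff p \in K -> (1 < #|` H|)%N.
Proof.
move=> pps pK; have e2 : #|` [fset 0; diff p]| = 2.
  by rewrite cardfs2 eq_sym (diff_neq0 dec pps).
suff: (#|` [fset 0%R; diff p]| <= #|` H|)%N by rewrite e2.
apply: fsubset_leq_card; apply/fsubsetP=> g; rewrite in_fset2 => /orP [] /eqP ->.
  exact: hH.1.
exact: KH.
Qed.

(** Since [p] is redundant, replacing its second term by [w] keeps all sums of [D]. By maximality it
    adds none, so w - p.1 is a period. *)
Lemma unpaired_in_coset p w : p \in ps -> diff p \in K -> w \in bs ++ ys -> w - p.1 \in H.
Proof.
move=> pps pK wW; have pp := perm_to_rem pps; set qs := rem p ps in pp.
case: (eqVneq p.1 w) => [->|pw]; first by rewrite subrr; apply: hH.1.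
have red := K_pair_redundant pK pp.
have DE : D = subsums (diffs qs).
  by rewrite /D (subsums_diffs_perm pp) /= subsums_cons_stab.
move: (decomp_perm pp dec) pw; case: (p) => a b /decomp_swap sw /= pw.
have [bs' [ys' dec']] := sw _ wW pw.
have := mx dec'; rewrite -/D DE /= /diff /= => le.
rewrite in_stabE // DE; apply: contraTT le => ne.
by rewrite -ltnNge subsums_cons_lt.
Qed.

(* Otherwise exchanging {a,b}, {c,d} for {a,c}, {b,d} keeps all sums, since b - a is in
   [K], and increases the number of differences outside [H]. *)
Lemma outside_pair_meets p q : p \in ps -> diff p \in K -> q \in ps -> diff q \notin K ->
  meets p.1 H q.
Proof.
move=> pps pK qps qK; apply/negPn/negP; rewrite negb_or => /andP [cH dH].
have pq : p != q by apply: contraNneq qK => <-.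
have [rs prs] := perm_two pps qps pq.
have Hgt := card_H_gt1 pps pK.
move: (decomp_perm prs dec) => dec1.
(* As [diff q] is not in [K], removing both pairs costs only one difference in [K]. *)
have E : translate (diff p) (subsums (diffs rs)) = subsums (diffs rs).
  apply: (@K_periodic [:: p; q] rs) => //.
  by move: cK; rewrite (inside_perm _ prs) /inside /= pK (negbTE qK) add0n; case: #|` K|.
have pqs : perm_eq ps (q :: p :: rs).
  by apply: perm_trans prs _; apply/permP=> u /=; clear; lia.
have DE : D = subsums (diffs rs) `|` translate (diff q) (subsums (diffs rs)).
  by rewrite /D (subsums_diffs_perm pqs) /= subsums_cons subsums_cons_stab.
have pH := KH pK.
case: p q cH dH pK pps qps qK pq prs dec1 E pqs DE pH => a b [c d] /=; rewrite /diff /=.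
move=> cH dH pK pps qps qK pq prs dec1 E pqs DE pH.
have ac : a != c by apply: contraNneq cH => ->; rewrite subrr; apply: hH.1.
have dbH : d - b \notin H.
  rewrite (_ : d - b = d - a - (b - a)); last by zmod.
  by rewrite subgrpDr // subgrpN.
have bd : b != d by apply: contraNneq dbH => ->; rewrite subrr; apply: hH.1.
have dec2 := decomp_exchange dec1 ac bd.
set qs := [:: (a, c), (b, d) & rs] in dec2.
(* Here (c - a) + (d - c) = (d - b) + (b - a), where b - a is a period of [F]. *)
have sub : translate (c - a) D `<=` subsums (diffs qs).
  rewrite /= /diff /= DE !subsums_cons; set F := subsums _ in E *.
  apply/fsubsetP=> z; rewrite !(in_translate, in_fsetU) => /orP [->|h].
    by rewrite orbT.
  move: h; rewrite (_ : z - (c - a) - (d - c) = z - (d - b) - (b - a)); last by zmod.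
  by rewrite -in_translate E => ->; rewrite orbT.
have {sub}DE2 : translate (c - a) D = subsums (diffs qs).
  by apply: translate_subset_eq sub _; apply: mx dec2.
have mx2 : maximal n m S qs.
  by apply: maximal_card mx; rewrite -DE2 card_translate.
have HE2 : stab (subsums (diffs qs)) = H by rewrite -DE2 stab_translate.
have out2 : outside H qs = (outside H rs).+2.
  by rewrite /outside /= /diff /= cH dbH.
have out1 : (outside H ps <= (outside H rs).+1)%N.
  rewrite (outside_perm _ prs) /outside /= /diff /= pH /= add0n -add1n leq_add2r.
  by case: (_ \in _).
(* With u + 2 differences outside [H], Kneser's bound gives |H| (u + 3) <= m + 1; as |H| >= 2, the
   other m - u - 2 number at least |H|. *)
have hin : (#|` H| <= inside H qs)%N.
  have := card_subsums_stab (diffs qs); rewrite HE2 -/(outside H qs) out2 => b1.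
  have := inside_outside H qs; case: (dec2) => _ _ -> _; rewrite out2 => b2.
  have b3 := leq_trans b1 (leq_trans (card_decomp_le mn dec2) small).
  move: Hgt b2 b3; move: (outside H rs) (inside H qs) (#|` H|) => u v h.
  move=> h1 e; rewrite mulnC !mulSn; have : (u <= u * h)%N by rewrite leq_pmulr // ltnW.
  by move: h1 e (u * h)%N => h1 e uh; move: h1 e; clear; lia.
by have := outmax dec2 mx2; rewrite /= HE2 => /(_ hin); rewrite out2; move: out1; clear; lia.
Qed.

Lemma D_period g z : g \in H -> (z + g \in D) = (z \in D).
Proof. by move=> /stabP gH; rewrite -{1}gH in_translate addrK. Qed.

(** * Two pairs with differences in [K] that lie in different cosets of [H] *)

Section FarPairs.
Variables (a b c d : G) (rs : seq (G * G)).
Hypotheses (prs : perm_eq ps [:: (a, b), (c, d) & rs]).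
Hypotheses (abK : b - a \in K) (cdK : d - c \in K) (far : c - a \notin H).
Let F := subsums (diffs rs).

Let abH : b - a \in H := KH abK.
Let cdH : d - c \in H := KH cdK.

Let apart x y : x - a \in H -> y - c \in H -> x - y \notin H.
Proof.
move=> xa yc; apply: contra far => xy.
rewrite (_ : c - a = (x - a) - (x - y) - (y - c)); last by zmod.
exact: hH.2 (hH.2 _ _ xa xy) yc.
Qed.

Let aa : a - a \in H. Proof. by rewrite subrr; apply: hH.1. Qed.
Let cc : c - c \in H. Proof. by rewrite subrr; apply: hH.1. Qed.

Let apart_neq x y : x - a \in H -> y - c \in H -> x != y.
Proof.
by move=> xa yc; apply: contraNneq (apart xa yc) => ->; rewrite subrr; apply: hH.1.
Qed.

Let DE : D = subsums [:: b - a, d - c & diffs rs].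
Proof. exact: subsums_diffs_perm prs. Qed.

(** With more than |K| differences in [K], both pairs could be dropped, so D = F. Exchanging them
    for {a, c}, {b, d} would then make c - a a period of [D]. *)
Lemma inside_K_far : inside K ps = #|` K|.
Proof.
apply/eqP; rewrite eqn_leq cK andbT leqNgt; apply/negP => big.
have cF : (#|` K|.-1 <= inside K rs)%N.
  move: big; rewrite (inside_perm _ prs) /inside /= /diff /= abK cdK.
  by case: #|` K|.
have st g : g \in K -> translate g F = F by apply: (@K_periodic [:: (a, b); (c, d)]).
have DF : D = F.
  rewrite DE subsums_cons_stab; last by rewrite subsums_cons_stab st.
  by rewrite subsums_cons_stab // st.
have dec2 := decomp_exchange (decomp_perm prs dec) (apart_neq aa cc) (apart_neq abH cdH).
have s1 : translate 0 F `<=` subsums (diffs [:: (a, c), (b, d) & rs]).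
  rewrite translate0 /= subsums_cons; apply: fsubsetU.
  by rewrite subsums_cons fsubsetUl.
have e1 := translate_subset_eq s1; rewrite translate0 -DF in e1.
have {}e1 := e1 (mx dec2).
have s2 : translate (c - a) D `<=` D.
  rewrite {2}e1 DF /= (subsums_cons (diff (a, c))); apply: fsubsetU.
  by rewrite translateS ?orbT // subsums_cons fsubsetUl.
by move/negP: far; apply; rewrite in_stabE // (translate_subset_eq s2).
Qed.

(** An unpaired term would lie in both a + H and c + H. *)
Lemma unpaired_far : bs = [::] /\ ys = [::].
Proof.
have aps : (a, b) \in ps by rewrite (perm_mem prs) mem_head.
have cps : (c, d) \in ps by rewrite (perm_mem prs) !inE eqxx orbT.
suff : bs ++ ys = [::] by case: (bs); case: (ys).
case E : (bs ++ ys) => [//|w l]; have wE : w \in bs ++ ys by rewrite E mem_head.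
have := apart_neq (unpaired_in_coset aps abK wE) (unpaired_in_coset cps cdK wE).
by rewrite eqxx.
Qed.

(** A pair with difference in [H] but not in [K] would meet both a + H and c + H, although its terms
    lie in one coset. *)
Lemma inside_H_far : inside H ps = #|` K|.
Proof.
rewrite -inside_K_far /inside !count_map; apply: eq_in_count => q qps /=.
apply/idP/idP => [qH|/KH //]; apply/negPn/negP => qK.
have aps : (a, b) \in ps by rewrite (perm_mem prs) mem_head.
have cps : (c, d) \in ps by rewrite (perm_mem prs) !inE eqxx orbT.
have q12 x : (q.1 - x \in H) = (q.2 - x \in H).
  rewrite (_ : q.2 - x = (q.1 - x) + diff q); last by rewrite /diff; zmod.
  by rewrite (subgrpDr hH _ qH).
have := outside_pair_meets aps abK qps qK; rewrite /meets -q12 orbb /= => qa.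
have := outside_pair_meets cps cdK qps qK; rewrite /meets -q12 orbb /= => qc.
by have := apart_neq qa qc; rewrite eqxx.
Qed.

(** Otherwise b - c would be a period of [D], as b - a and d - c are periods and [D] is [F] plus
    their subset sums. *)
Lemma far_witness : exists2 f, f \in F & f + (b - c) \notin D.
Proof.
case: (boolP [forall f : F, val f + (b - c) \in D]) => [/forallP all_in|]; last first.
  by rewrite negb_forall => /existsP [f fD]; exists (val f) => //; apply: valP.
have {}all_in f : f \in F -> f + (b - c) \in D by move=> fF; apply: (all_in [` fF]).
exfalso; have s : translate (b - c) D `<=` D.
  apply/fsubsetP=> z; rewrite in_translate {1}DE !subsums_cons.
  rewrite !(in_fsetU, in_translate) -!orbA => /or4P [] /all_in h.
  - have e : z - (b - c) + (b - c) = z by zmod.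
    by rewrite -e; exact: h.
  - have e : z - (b - c) - (d - c) + (b - c) + (d - c) = z by zmod.
    by rewrite -e D_period //; exact: h.
  - have e : z - (b - c) - (b - a) + (b - c) + (b - a) = z by zmod.
    by rewrite -e D_period //; exact: h.
  - have e : z - (b - c) - (b - a) - (d - c) + (b - c) + ((b - a) + (d - c)) = z by zmod.
    by rewrite -e D_period; [exact: h|exact: subgrpD].
have bc : b - c \in H by rewrite in_stabE // (translate_subset_eq s).
by move: (apart abH cc); rewrite bc.
Qed.

(* The extra sums use both a and b, and neither c nor d. *)
Lemma card_Sigma_far :
  (#|` D| + #|` subsums [seq g <- diffs rs | g \in K]| <= #|` Sigma n S|)%N.
Proof.
have [bs0 ys0] := unpaired_far.
have [f fF fD] := far_witness.
set Y := subsums _.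
have FE : F = sumset Y (subsums [seq g <- diffs rs | g \notin K]).
  by rewrite -subsums_cat; apply: subsums_perm; rewrite perm_sym perm_filterC.
(* Only the part [w0] of [f] is kept fixed. Letting the other part run through [Y], a subset of [K],
   gives |Y| sums outside the translate of [D]. *)
move: fF; rewrite FE => /in_sumset [y0 [w0 [y0Y w0Z fE]]].
have YK : Y `<=` K by apply: subsums_sub => //; apply: filter_all.
have [pS _ szp szb] := decomp_perm prs dec.
have XS := decomp_sub mn dec.
set s := \sum_(p <- rs) p.1.
have bE : base ps bs = a + c + s.
  by rewrite (base_perm bs prs) /base bs0 big_nil !big_cons /= -/s; zmod.
have VS : translate (s + (a + b) + w0) Y `<=` Sigma n S.
  apply/fsubsetP=> z; rewrite in_translate => zY.
  rewrite (_ : z = s + \sum_(t <- [:: a; b]) t + (w0 + (z - (s + (a + b) + w0)))); last first.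
    by rewrite !big_cons big_nil; zmod.
  apply: (@Sigma_pairs _ n S rs [:: a; b] [:: c; d]).
  - apply: perm_trans pS _; rewrite bs0 ys0; apply/permP=> u /=.
    by rewrite !count_cat /=; clear; lia.
  - by move: szb szp mn; rewrite bs0 /=; clear; lia.
  - by rewrite -/F FE addrC mem_sumset.
rewrite -(card_translate (base ps bs) D) -(card_translate (s + (a + b) + w0) Y).
set X := translate _ D in XS *; set V := translate _ Y in VS *.
have XV : X `&` V = fset0.
  apply/eqP; rewrite -fsubset0; apply/fsubsetP=> z.
  rewrite in_fsetI !in_translate => /andP [zD zY]; move: fD.
  have e : f + (b - c) = z - base ps bs + (y0 - (z - (s + (a + b) + w0))).
    by rewrite fE bE; zmod.
  rewrite e D_period ?zD //; apply: KH; apply: hK.2; exact: (fsubsetP YK).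
rewrite -[X in (X <= _)%N]subn0 -(cardfs0 G) -XV -cardfsU.
by apply: fsubset_leq_card; rewrite fsubUset XS VS.
Qed.

(** The extra sums leave so little room that the two pairs are all of [S] and |K| = m = n = 2. *)
Lemma far_pairs_klein : #|` Sigma n S| = m.+1 /\ klein_coset n S.
Proof.
have [bs0 ys0] := unpaired_far.
have aps : (a, b) \in ps by rewrite (perm_mem prs) mem_head.
have cps : (c, d) \in ps by rewrite (perm_mem prs) !inE eqxx orbT.
have [pS neS szp szb] := decomp_perm prs dec.
have ab0 : b - a != 0 by apply: (diff_neq0 dec aps).
have cd0 : d - c != 0 by apply: (diff_neq0 dec cps).
have Hgt := card_H_gt1 aps abK.
have iH := inside_H_far; have iK := inside_K_far.
have HK : #|` H| = #|` K|.
  by apply/eqP; rewrite eqn_leq (fsubset_leq_card K_sub_H) andbT -iH.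
have := leq_trans card_Sigma_far small.
set Y := subsums _ => le1.
have le2 := card_subsums_stab (diffs ps); rewrite -/D -/H -/(outside H ps) HK in le2.
have le3 := inside_outside H ps; rewrite iH in le3.
have sps : size ps = m by case: dec.
rewrite sps in le3.
have Y0 : (0 < #|` Y|)%N by rewrite cardfs_gt0 subsums_neq0.
(* For u differences outside [H], |K| (u + 1) + |Y| <= m + 1 = |K| + u + 1, where |K| >= 2 and |Y|
   >= 1. *)
have [out0 Y1] : outside H ps = 0%N /\ #|` Y| = 1%N.
  move: Hgt le1 le2 le3 Y0; rewrite HK; move: (outside H ps) (#|` K|) (#|` Y|) (#|` D|).
  clear; move: m => k u h v w h1 w1 w2 e v0; rewrite mulnS in w2.
  case: u w2 e => [|u] w2 e; first by split=> //; lia.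
  have : (u.+1 * 2 <= h * u.+1)%N by rewrite mulnC leq_mul2r h1 orbT.
  by move: (h * u.+1)%N w2 => uh w2; lia.
have m2 : #|` K| = m by rewrite -le3 out0 addn0.
have K2 : inside K rs = 0%N.
  rewrite -[LHS]size_filter; case E : [seq g <- diffs rs | g \in K] => [//|g l].
  have gm : g \in [seq g <- diffs rs | g \in K] by rewrite E mem_head.
  move: gm; rewrite mem_filter => /andP [_ /mapP [r rrs gE]].
  have rps : r \in ps by rewrite (perm_mem prs) !inE rrs !orbT.
  have := diff_neq0 dec rps; rewrite -gE => g0.
  have s : [fset 0%R; g] `<=` Y.
    apply/fsubsetP=> z; rewrite in_fset2 => /orP [] /eqP ->; first exact: subsums0.
    by rewrite /Y E subsums_cons in_fsetU in_translate subrr subsums0 orbT.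
  by have := fsubset_leq_card s; rewrite cardfs2 eq_sym g0 Y1.
have {}K2 : #|` K| = 2.
  by rewrite -iK (inside_perm _ prs) /inside /= -/(inside K rs) K2 /diff /= abK cdK.
have {}m2 : m = 2 by rewrite -m2.
have rs0 : rs = [::] by move: szp; rewrite m2; case: (rs).
have n2 : n = 2 by move: szb mn; rewrite bs0 m2 /=; clear; lia.
have KE : K = [fset 0; b - a].
  apply/eqP; rewrite eq_sym eqEfcard cardfs2 eq_sym ab0 K2 andbT.
  by apply/fsubsetP=> z; rewrite in_fset2 => /orP [] /eqP -> //; apply: hK.1.
have cdE : b - a = d - c.
  by move: cdK; rewrite KE in_fset2 (negbTE cd0) => /eqP ->.
have hh : (b - a) + (b - a) = 0.
  have : (b - a) + (b - a) \in K by apply: subgrpD.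
  rewrite KE in_fset2 => /orP [/eqP //|]; rewrite -subr_eq0 addrK => /eqP z0.
  by rewrite z0 eqxx in ab0.
have {}pS : perm_eq S [:: a; b; c; d] by move: pS; rewrite rs0 bs0 ys0.
have ca := apart_neq aa cc; have cb := apart_neq abH cc.
have dH : d - c \in H by []. have da := apart_neq aa dH; have db := apart_neq abH dH.
have Sig x y z t : perm_eq [:: a; b; c; d] [:: x; y; z; t] -> x + y \in Sigma n S.
  move=> q; have := @SigmaI _ n S [:: x; y] [:: z; t].
  by rewrite !big_cons big_nil addr0 n2; apply=> //; apply: perm_trans pS q.
have s1 : a + c \in Sigma n S by apply: (Sig _ _ b d); apply/permP=> u /=; clear; lia.
have s2 : a + d \in Sigma n S by apply: (Sig _ _ b c); apply/permP=> u /=; clear; lia.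
have s3 : a + b \in Sigma n S by apply: (Sig _ _ c d); apply/permP=> u /=; clear; lia.
have s4 : c + d \in Sigma n S by apply: (Sig _ _ a b); apply/permP=> u /=; clear; lia.
have cd : c != d by rewrite -subr_eq0 -opprB oppr_eq0.
have u3 : uniq [:: a + b; a + c; a + d].
  by rewrite /= !inE !(inj_eq (addrI a)) negb_or cb db cd.
have card3 : (3 <= #|` Sigma n S|)%N.
  apply: (uniq_leq_size u3) => z; rewrite !inE => /or3P [] /eqP ->; exact.
(* Otherwise there are four sums, more than m + 1 = 3. With b - a = d - c, this equation makes c - a
   an involution. *)
have cdab : c + d = a + b.
  case: (eqVneq (c + d) (a + b)) => // ne4.
  have u4 : uniq [:: c + d; a + b; a + c; a + d].
    rewrite cons_uniq u3 andbT !inE !negb_or ne4 /= addrC (inj_eq (addIr c)) eq_sym da.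
    by rewrite addrC (inj_eq (addIr d)) eq_sym ca.
  have : (4 <= #|` Sigma n S|)%N.
    by apply: (uniq_leq_size u4) => z; rewrite !inE => /or4P [] /eqP ->.
  by move: small; rewrite m2; clear; lia.
split; first by apply/eqP; rewrite eqn_leq small m2 card3.
have ab : a != b by rewrite eq_sym -subr_eq0.
rewrite n2; apply: (klein_cosetI pS ab cdE hh); rewrite 1?eq_sym //.
rewrite (_ : _ + _ = (c + d) - (a + b) + ((b - a) - (d - c))); last by zmod.
by rewrite cdab cdE !subrr addr0.
Qed.

End FarPairs.

End Extremal.
(** [H] itself shows that a smallest [K] exists. Either the pairs with difference in [K] all lie in
    one coset of [H], or two of them are far apart. *)
Lemma clustered_decomp ps bs ys : decomp n m S ps bs ys -> maximal n m S ps ->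
  let H := stab (subsums (diffs ps)) in
  (#|` H| <= inside H ps)%N ->
  (forall ps' bs' ys', decomp n m S ps' bs' ys' -> maximal n m S ps' ->
    let H' := stab (subsums (diffs ps')) in
    (#|` H'| <= inside H' ps')%N -> (outside H' ps' <= outside H ps)%N) ->
  has_periodic_setpartition n S \/ (#|` Sigma n S| = m.+1 /\ klein_coset n S).
Proof.
move=> dec mx H many outmax.
have hH : subgrp H := stab_subgrp (subsums_neq0 _).
have [K [hK cK Kmin]] := min_subgrp hH many.
have : has (fun d => d \in K) (diffs ps).
  rewrite has_count; apply: leq_trans cK; rewrite cardfs_gt0; exact: subgrp_neq0.
rewrite has_map => /hasP [p pps /= pK].
have [qs pp] : exists qs, perm_eq ps (p :: qs).
  by exists (rem p ps); apply: perm_to_rem.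
case: (boolP (all (fun q => (diff q \in K) ==> (q.1 - p.1 \in H)) ps)).
  move=> /allP near; left.
  have HE : stab (subsums (diffs (p :: qs))) = H.
    by rewrite /H (subsums_diffs_perm pp).
  have hm : all (meets p.1 (stab (subsums (diffs (p :: qs))))) (p :: qs).
    rewrite -(perm_all _ pp) HE; apply/allP => q qps.
    case: (boolP (diff q \in K)) => qK.
      by have := near q qps; rewrite qK /= /meets => ->.
    exact: (outside_pair_meets dec mx outmax hK cK Kmin pps pK qps qK).
  have hw : all (fun w => w - p.1 \in stab (subsums (diffs (p :: qs)))) (bs ++ ys).
    rewrite HE; apply/allP => w wW.
    exact: (unpaired_in_coset dec mx hK cK Kmin pps pK wW).
  have dec' := decomp_perm pp dec.
  apply: (has_periodic_setpartitionI mn dec' _ hm hw).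
    exact: (Sigma_structured mn dec' hm hw).
  exact: (K_pair_redundant hK cK Kmin pK pp).
move=> /allPn [q qps]; rewrite negb_imply => /andP [qK far]; right.
have pq : p != q.
  by apply: contraNneq far => ->; rewrite subrr; apply: hH.1.
have [rs prs] := perm_two pps qps pq.
case: p q {pps qps qs pp pq} pK qK far prs => a b [c d] /= pK qK far prs.
exact: (far_pairs_klein dec mx many outmax hK cK Kmin prs pK qK far).
Qed.

End Clustered.

(** * Decompositions without redundant pairs *)

Section Irredundant.
Variable G : zmodType.
Implicit Types (S T R bs ys : seq G) (ps qs rs : seq (G * G)) (p q r : G * G)
  (a b c d e t w x z : G) (Z : {fset G}).

(** The redundant difference lies in [H], so |H| >= 2, and counting forces D = H. Then [Sigma n S]
    is a coset of [H], and [Sigma_swap] puts all of [S] into one. *)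
Lemma redundant_coset n S ps bs ys : (0 < n)%N -> (n < size S)%N -> (mpar n S <= n)%N ->
  (#|` Sigma n S| <= (mpar n S).+1)%N ->
  decomp n (mpar n S) S ps bs ys -> redundant (diffs ps) ->
  let H := stab (subsums (diffs ps)) in (inside H ps < #|` H|)%N ->
  has_periodic_setpartition n S.
Proof.
move=> n0 nS mn small dec [d [es [pd st]]] H few.
set D := subsums (diffs ps) in H few *.
have D0 : D != fset0 := subsums_neq0 _.
have hH : subgrp H := stab_subgrp D0.
have /mapP [p pps dE] : d \in diffs ps by rewrite (perm_mem pd) mem_head.
have [qs pp] : exists qs, perm_eq ps (p :: qs).
  by exists (rem p ps); apply: perm_to_rem.
have qE : subsums es = subsums (diffs qs).
  apply: subsums_perm; rewrite perm_sym -(perm_cons d).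
  by apply: perm_trans pd; rewrite dE perm_sym -/(diffs (p :: qs)) perm_map.
rewrite dE qE in st.
have DE : D = subsums (diffs qs) by rewrite /D (subsums_diffs_perm pp) /= subsums_cons_stab.
have pH : diff p \in H by rewrite in_stabE // DE st.
have Hgt : (1 < #|` H|)%N.
  have s : [fset 0; diff p] `<=` H.
    by apply/fsubsetP=> z; rewrite in_fset2 => /orP [] /eqP -> //; apply: hH.1.
  by have := fsubset_leq_card s; rewrite cardfs2 eq_sym (diff_neq0 dec pps).
have sz : size ps = mpar n S by case: dec.
have le1 := card_subsums_stab (diffs ps); rewrite -/D -/H -/(outside H ps) in le1.
have le2 := leq_trans (card_decomp_le mn dec) small; rewrite -/D in le2.
have le3 := inside_outside H ps; rewrite sz in le3.
(* With u differences inside [H] and v outside, |H| (v + 1) <= u + v + 1 <= |H| + v, so v = 0. *)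
have [DH Dm] : (#|` D| <= #|` H|)%N /\ (mpar n S < #|` D|)%N.
  move: le1 le2 le3 few Hgt.
  move: (inside H ps) (outside H ps) (#|` H|) (#|` D|) (mpar n S).
  clear=> u v h w m; rewrite mulnS; case: v => [|v] h1 h2 h3 h4 h5.
    by rewrite muln0 in h1; split; lia.
  have : (2 * v.+1 <= h * v.+1)%N by rewrite leq_mul2r h5 orbT.
  by move: (h * v.+1)%N h1 => hv h1; lia.
have HsD : H `<=` D.
  by apply/fsubsetP=> g /stabP gD; rewrite -gD in_translate subrr subsums0.
have {HsD DH}DH : D = H by apply/eqP; rewrite eq_sym eqEfcard HsD.
have XE : translate (base ps bs) D = Sigma n S.
  apply/eqP; rewrite eqEfcard (decomp_sub mn dec) card_translate.
  exact: leq_trans small Dm.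
have coset u w : u \in S -> w \in S -> u - w \in H.
  move=> uS wS; case: (Sigma_swap n0 nS uS wS) => [->|[z []]].
    by rewrite subrr; apply: hH.1.
  rewrite -XE !in_translate DH => zu zw.
  rewrite (_ : u - w = (z + u - base ps bs) - (z + w - base ps bs)); last by zmod.
  exact: hH.2.
have [pS _ _ _] := dec.
have inS q : q \in ps -> q.1 \in S.
  move=> qps; rewrite (perm_mem pS) mem_cat (perm_mem (flatp_perm (perm_to_rem qps))).
  by rewrite mem_head.
have HE : stab (subsums (diffs (p :: qs))) = H by rewrite /H /D (subsums_diffs_perm pp).
apply: (@has_periodic_setpartitionI G n S p qs bs ys p.1) => //.
- exact: decomp_perm pp dec.
- by rewrite -(base_perm bs pp) -(subsums_diffs_perm pp).
- rewrite -(perm_all _ pp) HE; apply/allP => q qps.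
  by rewrite /meets coset ?inS.
- rewrite HE; apply/allP => w wW; apply: coset (inS _ pps).
  by rewrite (perm_mem pS) mem_cat wW orbT.
Qed.

Lemma subsums_sub_closed Z ds : 0 \in Z -> (forall d z, d \in ds -> z \in Z -> z + d \in Z) ->
  subsums ds `<=` Z.
Proof.
move=> Z0; elim: ds => [|d ds IH] cl.
  by rewrite subsums_nil; apply/fsubsetP=> z; rewrite in_fset1 => /eqP ->.
have /fsubsetP s : subsums ds `<=` Z.
  by apply: IH => e z eds; apply: cl; rewrite inE eds orbT.
apply/fsubsetP=> z; rewrite subsums_cons in_fsetU in_translate => /orP [/s //|/s h].
by rewrite -(subrK d z) cl ?mem_head.
Qed.

(** Each copy of [d] enlarges the set until [d] becomes a period, which it then remains. *)
Lemma subsums_nseq_growth d k ds :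
  translate d (subsums (nseq k d ++ ds)) = subsums (nseq k d ++ ds) \/
  (#|` subsums ds| + k <= #|` subsums (nseq k d ++ ds)|)%N.
Proof.
elim: k => [|k IH]; first by right; rewrite addn0.
case: (eqVneq (translate d (subsums (nseq k d ++ ds))) (subsums (nseq k d ++ ds))).
  by move=> st; left; rewrite /= subsums_cons_stab.
move=> ne; right; rewrite addnS; apply: leq_ltn_trans (subsums_cons_lt ne).
by case: IH => // st; rewrite st eqxx in ne.
Qed.

Lemma card_subsums2 d e : d != 0 -> e != 0 -> d != e -> d != - e ->
  (4 <= #|` subsums [:: d; e]|)%N.
Proof.
move=> d0 e0 de dne.
have u4 : uniq [:: 0; d; e; d + e].
  rewrite /= !inE !negb_or ![0 == _]eq_sym d0 e0 addr_eq0 dne de /=.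
  by rewrite -{1}[d]addr0 (inj_eq (addrI d)) eq_sym e0 -{1}[e]add0r (inj_eq (addIr e)) eq_sym d0.
apply: (uniq_leq_size u4) => z; rewrite !inE.
rewrite !subsums_cons subsums_nil => zE.
rewrite !(in_fsetU, in_translate, in_fset1); move: zE => /or4P [] /eqP ->.
- by rewrite eqxx.
- by rewrite subrr eqxx !orbT.
- by rewrite subrr eqxx !orbT.
- by rewrite (_ : d + e - d - e = 0) ?eqxx ?orbT //; zmod.
Qed.

(** Reversing a pair negates its difference and only translates the set of subset sums. *)
Lemma pairs_orient d ps : d != 0 -> all (fun p => (diff p == d) || (diff p == - d)) ps ->
  exists qs, [/\ perm_eq (flatp ps) (flatp qs), all (fun p => diff p == d) qs,
    size qs = size ps & #|` subsums (diffs qs)| = #|` subsums (diffs ps)|].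
Proof.
move=> d0 al; suff [qs [p1 p2 p3 [g p4]]] : exists qs, [/\ perm_eq (flatp ps) (flatp qs),
    all (fun p => diff p == d) qs, size qs = size ps &
    exists g, subsums (diffs qs) = translate g (subsums (diffs ps))].
  by exists qs; split=> //; rewrite p4 card_translate.
elim: ps al => [_|p ps IH] /=.
  by exists [::]; split=> //; exists 0; rewrite translate0.
move=> /andP [pd /IH [qs [p1 p2 p3 [g p4]]]].
case/orP: pd => /eqP pd.
  exists (p :: qs); split=> /=; [by rewrite !perm_cons|by rewrite pd eqxx|by rewrite p3|].
  by exists g; rewrite !subsums_cons p4 -!translateD addrC translateD /translate imfsetU.
exists ((p.2, p.1) :: qs); split=> /=.
- apply/permP=> u /=; have /= := permP p1 u.
  by move: (count u (flatp ps)) (count u (flatp qs)) => i j; clear; lia.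
- by rewrite p2 andbT /diff /= -opprB -/(diff p) pd opprK.
- by rewrite p3.
exists (g - diff p); rewrite /diff /= !subsums_cons p4 -/(diff p).
apply/fsetP=> z; rewrite !(in_fsetU, in_translate) orbC; congr (_ || _).
  by rewrite (_ : z - (p.1 - p.2) - g = z - (g - diff p)) // /diff; zmod.
by rewrite (_ : z - (g - diff p) - diff p = z - g) //; zmod.
Qed.

End Irredundant.

(** * The shape of [S] when no large decomposition is redundant *)

Section Progression.
Variable G : zmodType.
Implicit Types (bs ys : seq G) (ps qs rs : seq (G * G)) (p q r : G * G)
  (a b c d e t w x z : G).

Definition near d t := t \in [:: 0; d; - d].

Variables (n : nat) (S : seq G).
Let m := mpar n S.
Hypotheses (n0 : (0 < n)%N) (mn : (m <= n)%N).
Hypothesis small : (#|` Sigma n S| <= m.+1)%N.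
Hypothesis irr : forall ps bs ys, decomp n m S ps bs ys ->
  (m < #|` subsums (diffs ps)|)%N -> ~ redundant (diffs ps).

Lemma card_good ps bs ys : decomp n m S ps bs ys -> (#|` subsums (diffs ps)| <= m.+1)%N.
Proof. by move=> /(card_decomp_le mn) /leq_trans; apply. Qed.

(** More than [m] sums attain the bound m + 1, so they exhaust [Sigma n S]. *)
Lemma Sigma_good ps bs ys : decomp n m S ps bs ys -> (m < #|` subsums (diffs ps)|)%N ->
  translate (base ps bs) (subsums (diffs ps)) = Sigma n S.
Proof.
move=> dec big; apply/eqP; rewrite eqEfcard (decomp_sub mn dec) card_translate.
exact: leq_trans small big.
Qed.

(** Otherwise the two differences give four sums and each of the other m - 2 adds at least one,
    exceeding m + 1. *)
Lemma good_diffs ps bs ys p q : decomp n m S ps bs ys ->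
  (m < #|` subsums (diffs ps)|)%N -> p \in ps -> q \in ps ->
  diff p = diff q \/ diff p = - diff q.
Proof.
move=> dec big pps qps; case: (eqVneq p q) => [->|pq]; first by left.
have [rs prs] := perm_two pps qps pq.
case: (eqVneq (diff p) (diff q)) => [|ne1]; first by left.
case: (eqVneq (diff p) (- diff q)) => [|ne2]; first by right.
have c4 := card_subsums2 (diff_neq0 dec pps) (diff_neq0 dec qps) ne1 ne2.
have pd : perm_eq (diffs ps) (diffs rs ++ [:: diff p; diff q]).
  by rewrite perm_sym perm_catC /= perm_sym; apply: (perm_map (@diff G) prs).
have nr : ~ redundant (diffs rs ++ [:: diff p; diff q]).
  by move=> r; apply: (irr dec big); apply: redundant_perm r; rewrite perm_sym.
have := card_subsums_cat nr; rewrite -(subsums_perm pd) size_map.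
have sz : size ps = m by case: dec.
move: sz (card_good dec) c4; rewrite (perm_size prs) /=; clear.
move: (#|` _|) (#|` _|) (size rs) m => u v s k *; exfalso; lia.
Qed.

Lemma decomp_one_supp p bs ys : decomp n m S [:: p] bs ys ->
  (m < #|` subsums (diffs [:: p])|)%N -> (#|` supp S| <= 2)%N.
Proof.
case: p => a b dec big; have XE := Sigma_good dec big.
have [pS _ sz sb] := dec; rewrite /= in sz; rewrite -sz in sb.
have DE z : (z \in subsums (diffs [:: (a, b)])) = (z == 0) || (z == b - a).
  rewrite subsums_cons subsums_nil in_fsetU in_translate !in_fset1 /diff /=.
  by rewrite subr_eq0.
suff s : supp S `<=` [fset a; b].
  by apply: leq_trans (fsubset_leq_card s) _; rewrite cardfs2; case: eqP.
apply/fsubsetP=> w; rewrite mem_supp (perm_mem pS) in_fset2 /= !inE mem_cat.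
case/or4P => [->|->|wb|wy]; rewrite ?orbT //.
- have pw := perm_to_rem wb; set bs' := rem w bs in pw.
  have := @Sigma_pairs _ n S [::] [:: a, b & bs'] (w :: ys) 0.
  rewrite subsums_nil in_fset1 eqxx -XE in_translate DE /base.
  rewrite (perm_big _ pw) !big_cons !big_nil /= => h.
  have {h} : (b - w == 0) || (b - w == b - a).
    rewrite (_ : b - w = 0 + (a + (b + \sum_(j <- bs') j)) + 0 -
      (a + 0 + (w + \sum_(j <- bs') j))); last by zmod.
    apply: h => //.
      apply: perm_trans pS _; apply/permP=> u.
      by rewrite /= !count_cat (permP pw) /=; clear; lia.
    by move: (perm_size pw) sb n0; rewrite /=; clear; lia.
  rewrite subr_eq0 (inj_eq (addrI b)) eqr_opp => /orP [] /eqP ->.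
    by rewrite eqxx orbT.
  by rewrite eqxx.
- have py := perm_to_rem wy; set ys' := rem w ys in py.
  have := @Sigma_pairs _ n S [::] (w :: bs) [:: a, b & ys'] 0.
  rewrite subsums_nil in_fset1 eqxx -XE in_translate DE /base.
  rewrite !big_cons !big_nil /= => h.
  have {h} : (w - a == 0) || (w - a == b - a).
    rewrite (_ : w - a = 0 + (w + \sum_(j <- bs) j) + 0 -
      (a + 0 + \sum_(j <- bs) j)); last by zmod.
    apply: h => //.
      apply: perm_trans pS _; apply/permP=> u.
      by rewrite /= !count_cat (permP py) /=; clear; lia.
    by move: sb n0; rewrite /=; clear; lia.
  by rewrite subr_eq0 (inj_eq (addIr _)).
Qed.

(** * Decompositions whose pairs all have the same difference [d] *)

Section Fixed.
Variables (d : G) (ps : seq (G * G)) (bs ys : seq G).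
Hypotheses (dec : decomp n m S ps bs ys) (big : (m < #|` subsums (diffs ps)|)%N).
Hypotheses (m2 : (1 < m)%N) (psd : all (fun p => diff p == d) ps).

Let szps : size ps = m. Proof. by case: dec. Qed.

Lemma d_neq0 : d != 0.
Proof.
have [p pps] : exists p, p \in ps.
  by case: (ps) szps m2 => [<- //|p l _ _]; exists p; rewrite mem_head.
by have := diff_neq0 dec pps; rewrite (eqP (allP psd _ pps)).
Qed.

Lemma diffs_nseq qs : all (fun p => diff p == d) qs -> diffs qs = nseq (size qs) d.
Proof. by elim: qs => //= q qs IH /andP [/eqP -> /IH ->]. Qed.

Lemma pair_snd p : p \in ps -> p.2 = p.1 + d.
Proof. by move=> /(allP psd) /eqP <-; rewrite /diff; zmod. Qed.

Lemma card_nseq : (m < #|` subsums (nseq m d)|)%N.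
Proof. by move: big; rewrite (diffs_nseq psd) szps. Qed.

(** Exchanging [b] for [w] gives a decomposition that is still large, and as m >= 2 [good_diffs]
    compares w - a with a remaining difference [d]. *)
Lemma decomp_head_near a b qs w :
  decomp n m S ((a, b) :: qs) bs ys -> all (fun p => diff p == d) qs ->
  perm_eq (nseq m d) (d :: diffs qs) -> w \in bs ++ ys -> near d (w - a).
Proof.
move=> dec1 qsd pd wW; rewrite /near.
case: (eqVneq a w) => [->|aw]; first by rewrite subrr mem_head.
have [bs' [ys' dec2]] := decomp_swap dec1 wW aw.
set e := w - a; have e0 : e != 0 by rewrite subr_eq0 eq_sym.
set W := subsums (diffs qs).
have szq : (size qs).+1 = m by case: dec1.
have nr : ~ redundant (diffs qs).
  move=> r; apply: (irr dec big); apply: (@redundant_perm _ (d :: diffs qs)).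
    by rewrite (diffs_nseq psd) szps perm_sym.
  exact: redundant_cons.
have Wm : (m <= #|` W|)%N by have := card_subsums nr; rewrite size_map szq.
have V : #|` subsums (d :: diffs qs)| = m.+1.
  apply/eqP; rewrite -(subsums_perm pd) eqn_leq card_nseq andbT.
  by have := card_good dec; rewrite (diffs_nseq psd) szps.
(* If [e] were a period of [W], it would also be one after adding [d]. Then with a new sum v also e
   + v would be new, but only one sum is. *)
have st : translate e W != W.
  apply/eqP => st.
  have stV : translate e (subsums (d :: diffs qs)) = subsums (d :: diffs qs).
    by rewrite -cat1s subsums_cat translate_sumsetr st.
  have WV : W `<=` subsums (d :: diffs qs) by rewrite subsums_cons fsubsetUl.
  have : ~~ (subsums (d :: diffs qs) `<=` W).
    apply/negP=> s; have VW : subsums (d :: diffs qs) = W by apply/eqP; rewrite eqEfsubset s.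
    by apply: (irr dec big); exists d, (diffs qs); split;
       [rewrite (diffs_nseq psd) szps|move: VW; rewrite subsums_cons => /esym VW;
        apply: translate_subset_eq => //; rewrite [X in _ `<=` X]VW fsubsetUr].
  move=> /fsubsetPn [v vV vW].
  have evV : e + v \in subsums (d :: diffs qs) by rewrite -stV in_translate addrC addKr.
  have evW : e + v \notin W by rewrite -st in_translate addrC addKr.
  have s : [fset e + v; v] `<=` subsums (d :: diffs qs) `\` W.
    by apply/fsubsetP=> z; rewrite in_fset2 in_fsetD => /orP [] /eqP ->; apply/andP.
  have := fsubset_leq_card s; rewrite cardfsDS // V cardfs2.
  rewrite -{2}[v]add0r (inj_eq (addIr v)) e0 /= => h.
  by move: Wm h; clear; move: (#|` _|) m => u k; lia.
have big2 : (m < #|` subsums (diffs ((a, w) :: qs))|)%N.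
  by apply: leq_ltn_trans Wm _; apply: subsums_cons_lt.
have [q qqs] : exists q, q \in qs.
  by case: (qs) szq m2 => [<- //|q l _ _]; exists q; rewrite mem_head.
have := good_diffs dec2 big2 (mem_head _ _) (_ : q \in (a, w) :: qs).
rewrite inE qqs orbT => /(_ isT); rewrite (eqP (allP qsd _ qqs)) /diff /= -/e !inE.
by case=> ->; rewrite eqxx ?orbT.
Qed.

(** Either term of the pair can be the one that is kept. *)
Lemma unpaired_near p w : p \in ps -> w \in bs ++ ys ->
  near d (w - p.1) /\ near d (w - p.1 - d).
Proof.
move=> pps wW; have pp := perm_to_rem pps; set qs := rem p ps in pp.
have qsd : all (fun p => diff p == d) qs.
  by move: psd; rewrite (perm_all _ pp) /= => /andP [].
have pd : perm_eq (nseq m d) (d :: diffs qs).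
  rewrite -szps -(diffs_nseq psd) -(eqP (allP psd _ pps)).
  exact: (perm_map (@diff G) pp).
have p2 := pair_snd pps.
have := decomp_perm pp dec; case: (p) p2 => a b /= -> dec1.
split; first exact: (decomp_head_near dec1 qsd pd wW).
by rewrite -addrA -opprD; apply: (decomp_head_near (decomp_flip dec1) qsd pd wW).
Qed.

(** Exchanging the pairs for {a, c} and {a + d, c + d} gives the difference t = c - a twice. A third
    pair allows a comparison with [d]; for m = 2 the sums are inspected directly. *)
Lemma pairs_near p q : p \in ps -> q \in ps -> near d (q.1 - p.1).
Proof.
move=> pps qps; rewrite /near; case: (eqVneq q.1 p.1) => [->|ac].
  by rewrite subrr mem_head.
have pq : p != q by apply: contraNneq ac => ->.
have [rs prs] := perm_two pps qps pq.
have rsd : all (fun p => diff p == d) rs.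
  by move: psd; rewrite (perm_all _ prs) /= => /and3P [].
have d0 := d_neq0.
have := decomp_perm prs dec; have := pair_snd pps; have := pair_snd qps.
case: p q ac {pps qps pq} prs => a b [c e] /= ac prs -> -> dec1.
have szr : (size rs).+2 = m by case: dec1.
set t := c - a; have t0 : t != 0 by rewrite subr_eq0.
case: (eqVneq t d) => [->|td]; first by rewrite !inE eqxx orbT.
case: (eqVneq t (- d)) => [->|tnd]; first by rewrite !inE eqxx !orbT.
exfalso; case E : rs szr rsd dec1 => [|r rs'] szr rsd dec1.
  (* Selecting a and a + d, but neither c nor c + d, puts d - t into {0, d, 2d}. *)
  have XE := Sigma_good dec big.
  have [pS _ _ sb] := dec1.
  have := @Sigma_pairs _ n S [::] [:: a, a + d & bs] [:: c, c + d & ys] 0.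
  rewrite subsums_nil in_fset1 eqxx -XE in_translate !big_cons !big_nil => h.
  have {h} : - t + d \in subsums (diffs ps).
    rewrite (_ : - t + d = 0 + (a + (a + d + \sum_(j <- bs) j)) + 0 - base ps bs); last first.
      by rewrite (base_perm bs prs) E /base !big_cons !big_nil /= /t; zmod.
    apply: h => //.
      by apply: perm_trans pS _; apply/permP=> u; rewrite /= !count_cat /=; clear; lia.
    by move: sb mn; rewrite -szr /=; clear; lia.
  rewrite (diffs_nseq psd) szps -szr /= !subsums_cons subsums_nil.
  rewrite !(in_fsetU, in_translate, in_fset1) addrK -opprD.
  have e1 : (- t + d == 0) = false by rewrite addrC subr_eq0 eq_sym (negbTE td).
  have e2 : (t + d == 0) = false by rewrite addr_eq0 (negbTE tnd).
  by rewrite !oppr_eq0 (negbTE t0) e1 e2.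
have bE : (a + d) != (c + d) by rewrite (inj_eq (addIr d)) eq_sym.
have ac' : a != c by rewrite eq_sym.
have dec2 := decomp_exchange dec1 ac' bE.
set qs2 := [:: (a, c), (a + d, c + d), r & rs'] in dec2.
have dE : diffs qs2 = t :: t :: nseq (size rs').+1 d.
  rewrite -(diffs_nseq rsd) /= /diff /= -/t; congr [:: _, _ & _]; rewrite /t; zmod.
have td' : d != t by rewrite eq_sym.
have tnd' : d != - t by rewrite -eqr_oppLR eq_sym.
have c4 := card_subsums2 d0 t0 td' tnd'.
(* One [t] is left out. The last two differences give four sums; the m - 3 further copies of [d]
   each add one, unless [d] is a period, in which case [W] contains all m + 1 sums of copies of
   [d]. *)
set W := subsums (nseq (size rs') d ++ [:: d; t]).
have Wbig : (m < #|` W|)%N.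
  case: (subsums_nseq_growth d (size rs') [:: d; t]) => [st|]; last first.
    by rewrite -/W; move: c4 szr; rewrite /=; clear; move: (#|` _|) (#|` _|) m => u v k; lia.
  apply: leq_trans card_nseq _; apply: fsubset_leq_card; apply: subsums_sub_closed.
    exact: subsums0.
  move=> e' z; rewrite mem_nseq => /andP [_ /eqP ->] zW.
  by rewrite /W -st in_translate addrK.
have big2 : (m < #|` subsums (diffs qs2)|)%N.
  rewrite dE; apply: leq_trans Wbig _; rewrite subsums_cons.
  apply: fsubset_leq_card; rewrite /W.
  have -> : subsums (nseq (size rs') d ++ [:: d; t]) = subsums (t :: nseq (size rs').+1 d).
    by apply: subsums_perm; apply/permP=> u; rewrite count_cat /= !count_nseq; clear; lia.
  exact: fsubsetUl.
have := good_diffs dec2 big2 (mem_head _ _) (_ : r \in _).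
rewrite !inE eqxx !orbT => /(_ isT); rewrite {1 3}/diff /= -/t.
have -> : diff r = d by move: rsd => /= /andP [/eqP].
by case=> e1; [rewrite e1 eqxx in td|rewrite e1 eqxx in tnd].
Qed.

Lemma mem_flatp w qs : w \in flatp qs -> exists2 q, q \in qs & w = q.1 \/ w = q.2.
Proof.
elim: qs => [//|q qs IH] /=; rewrite !inE => /or3P [/eqP ->|/eqP ->|/IH [r rqs wr]].
- by exists q; [rewrite mem_head|left].
- by exists q; [rewrite mem_head|right].
- by exists r => //; rewrite inE rqs orbT.
Qed.

Lemma supp_cases w : w \in S ->
  (exists2 q, q \in ps & w = q.1 \/ w = q.1 + d) \/ w \in bs ++ ys.
Proof.
have [pS _ _ _] := dec; rewrite (perm_mem pS) mem_cat => /orP [/mem_flatp [q qps wq]|]; last by right.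
by left; exists q => //; rewrite -(pair_snd qps).
Qed.

Lemma nearP t : near d t -> [\/ t = 0, t = d | t = - d].
Proof.
rewrite /near !inE => /or3P [] /eqP ->; [exact: Or31|exact: Or32|exact: Or33].
Qed.

Lemma exists_pair : exists p, p \in ps.
Proof. by case: (ps) szps m2 => [<- //|p l _ _]; exists p; rewrite mem_head. Qed.

(** Otherwise copies of [d] would have at most two sums, fewer than m + 1. *)
Lemma two_d_neq0 : d + d != 0.
Proof.
apply/eqP => dd; have s : subsums (nseq m d) `<=` [fset 0; d].
  apply: subsums_sub_closed; first by rewrite in_fset2 eqxx.
  move=> e z; rewrite mem_nseq => /andP [_ /eqP ->]; rewrite !in_fset2 => /orP [] /eqP ->.
    by rewrite add0r eqxx orbT.
  by rewrite dd eqxx.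
have := leq_trans card_nseq (fsubset_leq_card s).
by rewrite cardfs2; move: m2; clear; case: (_ != _); lia.
Qed.

Definition Z3_coset :=
  m = 2%N /\ exists (x : G) (f : 'Z_3 -> G),
    [/\ forall u v, f (u + v) = f u + f v, injective f &
        supp S = [fset (x + f k) | k : 'Z_3]].

Lemma forall_Z3 (P : 'Z_3 -> Prop) : P 0 -> P 1 -> P (1 + 1) -> forall k, P k.
Proof.
move=> P0 P1 P2 [[|[|[|//]]] k].
- by rewrite (_ : Ordinal k = 0) //; apply: val_inj.
- by rewrite (_ : Ordinal k = 1) //; apply: val_inj.
- by rewrite (_ : Ordinal k = 1 + 1) //; apply: val_inj.
Qed.

(** Copies of [d] have at most the three sums 0, d, 2d, so m = 2, and nearness to one pair confines
    [S] to a coset of these. *)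
Lemma three_d_eq0_shape : d + d + d = 0 -> Z3_coset \/ (#|` supp S| <= 2)%N.
Proof.
move=> ddd; have d0 := d_neq0; have dd0 := two_d_neq0.
have dN : - d = d + d by rewrite -[LHS]add0r -ddd addrK.
have m2E : m = 2.
  pose Z := [fset 0; d] `|` [fset (d + d)].
  have s : subsums (nseq m d) `<=` Z.
    apply: subsums_sub_closed; first by rewrite !inE eqxx.
    move=> e z; rewrite mem_nseq => /andP [_ /eqP ->].
    rewrite !inE -!orbA => /or3P [] /eqP ->.
    - by rewrite add0r eqxx orbT.
    - by rewrite eqxx !orbT.
    - by rewrite ddd eqxx.
  have := leq_trans card_nseq (fsubset_leq_card s).
  have := (leq_card_fsetU [fset 0; d] [fset (d + d)]).1; rewrite -/Z cardfs1 cardfs2.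
  by move: m2; clear; case: (_ != _); move: (#|` _|) m => u v; lia.
have [p pps] := exists_pair; set a := p.1.
have un : uniq [:: a; a + d; a + (d + d)].
  rewrite /= !inE !negb_or -{1 3}[a]addr0 !(inj_eq (addrI a)) ![0 == _]eq_sym d0 dd0 /=.
  by rewrite -{1}[d]addr0 (inj_eq (addrI d)) eq_sym d0.
have sub w : w \in S -> w \in [:: a; a + d; a + (d + d)].
  have near3 w' : near d (w' - a) -> w' \in [:: a; a + d; a + (d + d)].
    move=> /nearP; rewrite dN => -[] e; rewrite !inE.
    - by rewrite (_ : w' = a) ?eqxx //; zmod_from e.
    - by rewrite (_ : w' = a + d) ?eqxx ?orbT //; zmod_from e.
    - by rewrite (_ : w' = a + (d + d)) ?eqxx ?orbT //; zmod_from e.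
  case/supp_cases => [[q qps wq]|wW]; last exact: near3 (unpaired_near pps wW).1.
  have := near3 _ (pairs_near pps qps); case: wq => -> //.
  rewrite !inE => /or3P [] /eqP ->.
  - by rewrite eqxx orbT.
  - by rewrite -addrA eqxx !orbT.
  - by rewrite -addrA ddd addr0 eqxx.
case: (leqP #|` supp S| 2) => [|big3]; [by right|left].
have suppE : supp S =i [:: a; a + d; a + (d + d)].
  have s : {subset enum_fset (supp S) <= [:: a; a + d; a + (d + d)]}.
    by move=> w; rewrite mem_supp; apply: sub.
  have [_ e] := uniq_min_size (fset_uniq (supp S)) s big3.
  by move=> w; rewrite -e.
(* Addition in ['Z_3] reduces representatives modulo 3, which multiples of [d] do not notice. *)
have d3 k : d *+ (k %% 3) = d *+ k.
  rewrite [in RHS](divn_eq k 3) mulrnDr mulnC mulrnA.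
  by rewrite (_ : d *+ 3 = 0) ?mul0rn ?add0r // !mulrS mulr0n addr0 addrA.
pose f (k : 'Z_3) := d *+ k.
have f0 : f 0 = 0 by [].
have f1 : f 1 = d by [].
have f2 : f (1 + 1) = d + d by [].
have fD u v : f (u + v) = f u + f v by rewrite /f -mulrnDr -[RHS]d3.
split=> //; exists a, f; split=> //.
- move=> u v uv; have : f (u - v) = 0 by apply: (addIr (f v)); rewrite -fD subrK add0r.
  have inj0 k : f k = 0 -> k = 0.
    move: k; apply: forall_Z3; rewrite ?f0 ?f1 ?f2 // => q; exfalso.
    + by rewrite q eqxx in d0.
    + by rewrite q eqxx in dd0.
  by move=> /inj0 /eqP; rewrite subr_eq0 => /eqP.
apply/fsetP=> w; rewrite suppE; apply/idP/imfsetP.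
  rewrite !inE => /or3P [] /eqP ->.
  - by exists 0 => //; rewrite f0 addr0.
  - by exists 1 => //; rewrite f1.
  - by exists (1 + 1) => //; rewrite f2.
move=> [k _ ->]; move: k; apply: forall_Z3; rewrite ?f0 ?f1 ?f2 !inE ?addr0 eqxx ?orbT //.
Qed.

(** The sets {-d, 0, d} and {0, d, 2d} share only 0 and d, as -d is none of 0, d, 2d. *)
Lemma near_both t : d + d + d != 0 -> near d t -> near d (t - d) -> t = 0 \/ t = d.
Proof.
move=> ddd /nearP [] ->; [by left|by right|].
case/nearP=> e; exfalso.
- by case/negP: two_d_neq0; apply/eqP; zmod_from e.
- by case/negP: ddd; apply/eqP; zmod_from e.
- by case/negP: d_neq0; apply/eqP; zmod_from e.
Qed.

(** If all pairs coincide, unpaired terms repeat their two values. Otherwise some [x] equals every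
    unpaired term and lies in every pair, hence occurs |S| - m times. *)
Lemma progression_shape : d + d + d != 0 -> (#|` supp S| <= 2)%N \/
  exists x : G, [/\ supp S `<=` [fset x - d; x; x + d], count_mem x S = hmax S &
    (size S - m <= hmax S)%N].
Proof.
move=> ddd; have [p pps] := exists_pair; set a := p.1.
have d0 := d_neq0; have dd0 := two_d_neq0.
have two q w : q \in ps -> w \in bs ++ ys -> w = q.1 \/ w = q.1 + d.
  move=> qps wW; have [h1 h2] := unpaired_near qps wW.
  by case: (near_both ddd h1 h2) => e; [left|right]; zmod_from e.
case: (boolP (all (fun q => q.1 == a) ps)) => [/allP same|/allPn [q qps qa]].
  left; suff s : supp S `<=` [fset a; a + d].
    by apply: leq_trans (fsubset_leq_card s) _; rewrite cardfs2; case: eqP.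
  apply/fsubsetP=> w; rewrite mem_supp in_fset2.
  case/supp_cases => [[q qps]|wW]; last first.
    by case: (two p w pps wW) => ->; rewrite eqxx ?orbT.
  by rewrite (eqP (same q qps)) => -[] ->; rewrite eqxx ?orbT.
right.
(* Two pairs with different first terms are {x - d, x} and {x, x + d}, where [x] is their common
   term. *)
have [x [[r [rps rE]] [v [vps vE]]]] : exists x, (exists r, r \in ps /\ r.1 = x - d) /\
    (exists v, v \in ps /\ v.1 = x).
  case/nearP: (pairs_near pps qps) => e.
  - by move: qa; rewrite -subr_eq0 e eqxx.
  - by exists q.1; split; [exists p; split=> //; zmod_from e|exists q].
  - by exists a; split; [exists q; split=> //; rewrite /a; zmod_from e|exists p].
have unx w : w \in bs ++ ys -> w = x.
  move=> wW; case: (two r w rps wW); rewrite rE ?subrK // => wx.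
  case: (two v w vps wW); rewrite vE // wx => e.
  by case/negP: dd0; apply/eqP; zmod_from e.
have pairx u : u \in ps -> u.1 = x - d \/ u.1 = x.
  move=> ups; have h1 := pairs_near rps ups; have h2 := pairs_near vps ups.
  rewrite rE in h1; rewrite vE in h2.
  have h3 : near d (u.1 - (x - d) - d) by rewrite (_ : _ - _ = u.1 - x) //; zmod.
  by case: (near_both ddd h1 h3) => e; [left|right]; zmod_from e.
have [pS _ _ sb] := dec.
have cx : (size S - m)%N = count_mem x S.
  have unc : count_mem x (bs ++ ys) = size (bs ++ ys).
    by apply/eqP; rewrite -all_count; apply/allP => w /unx ->; apply/eqP.
  have pc : count_mem x (flatp ps) = size ps.
    have h : {in ps, forall u, (u.1 == x) + (u.2 == x) = 1%N :> nat}%N.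
      move=> u ups; rewrite (pair_snd ups); case: (pairx u ups) => ->.
        rewrite subrK eqxx (_ : (x - d == x) = false) //.
        by rewrite -subr_eq0 addrC addKr oppr_eq0 (negbTE d0).
      rewrite eqxx (_ : (x + d == x) = false) //.
      by rewrite -subr_eq0 addrC addKr (negbTE d0).
    move: h; clear; elim: (ps) => [//|u l IH] h /=.
    have := h u (mem_head _ _); have := IH (fun v vl => h v (mem_behead (s := u :: l) vl)).
    by move=> /= ->; move: (u.1 == x) (u.2 == x) => i j; lia.
  rewrite (permP pS) count_cat unc pc (perm_size pS) (size_cat (flatp ps)) size_flatp szps.
  by clear; move: (size _) => k; lia.
have cle := count_le_hmax S x.
(* From m <= |S| - h(S); the bound h(S) <= |S| makes the truncated subtraction harmless. *)
have hle : (hmax S <= size S - m)%N.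
  have hS : (hmax S <= size S)%N.
    by rewrite /hmax; elim/big_ind: _ => // [i j|g _]; rewrite ?geq_max ?count_size // => -> ->.
  by move: hS; rewrite /m /mpar; clear; lia.
exists x; split; last by rewrite cx.
- apply/fsubsetP=> w; rewrite mem_supp !inE -!orbA.
  case/supp_cases => [[u ups]|/unx ->]; last by rewrite eqxx orbT.
  case: (pairx u ups) => -> [] ->; rewrite ?subrK eqxx ?orbT //.
- by apply/eqP; rewrite eqn_leq cle -cx hle.
Qed.

End Fixed.
Lemma irredundant_shape ps bs ys : (0 < m)%N -> decomp n m S ps bs ys ->
  (m < #|` subsums (diffs ps)|)%N ->
  [\/ Z3_coset, (#|` supp S| <= 2)%N |
    exists x d : G, [/\ supp S `<=` [fset x - d; x; x + d], count_mem x S = hmax S &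
      (size S - m <= hmax S)%N]].
Proof.
move=> m0 dec big; have [pS ne sz sb] := dec.
case E : ps sz => [|p ps'] sz; first by rewrite -sz in m0.
have pps : p \in ps by rewrite E mem_head.
case: (leqP m 1) => m1.
  have ps0 : ps' = [::].
    by apply/eqP; rewrite -size_eq0; move: sz m1; rewrite /=; clear; move: m => i; lia.
  by rewrite E ps0 in dec big; apply: Or32; apply: decomp_one_supp dec big.
have d0 := diff_neq0 dec pps; set d := diff p in d0.
have orient : all (fun q => (diff q == d) || (diff q == - d)) ps.
  apply/allP => q qps; have [->|->] := good_diffs dec big qps pps.
    by rewrite eqxx.
  by rewrite eqxx orbT.
have [qs [p1 p2 p3 p4]] := pairs_orient d0 orient.
have dec' : decomp n m S qs bs ys.
  split=> //; last by rewrite p3 E.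
    by apply: perm_trans pS _; rewrite perm_cat2r.
  by apply/allP => q /(allP p2) qd; rewrite eq_sym -subr_eq0 -/(diff q) (eqP qd).
rewrite -p4 in big.
case: (eqVneq (d + d + d) 0) => ddd.
  by case: (three_d_eq0_shape dec' big m1 p2 ddd) => h; [apply: Or31|apply: Or32].
case: (progression_shape dec' big m1 p2 ddd) => [h|[x h]]; [exact: Or32|].
by apply: Or33; exists x, d.
Qed.

End Progression.

(** * Extremal choices and the case distinction *)

Lemma exists_max (T : Type) (P : T -> Prop) (f : T -> nat) (B : nat) :
  (exists x, P x) -> (forall x, P x -> (f x <= B)%N) ->
  exists x, P x /\ forall y, P y -> (f y <= f x)%N.
Proof.
move=> [x Px] fB; elim: {x}(B - f x)%N {-2}x (leqnn (B - f x)) Px => [|k IH] x le Px.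
  by exists x; split=> // y /fB yB; move: le (fB _ Px) yB; clear; lia.
case: (classic (exists2 y, P y & (f x < f y)%N)) => [[y Py lt]|nex].
  by apply: (IH y) => //; move: le lt (fB _ Py); clear; lia.
by exists x; split=> // y Py; rewrite leqNgt; apply/negP => lt; apply: nex; exists y.
Qed.

(** As 0 < n < |S|, the minimum can vanish only through |S| = h(S). *)
Lemma mpar0_supp (G : zmodType) (n : nat) (S : seq G) : (0 < n)%N -> (n < size S)%N ->
  mpar n S = 0%N -> #|` supp S| = 1%N.
Proof.
move=> n0 nS m0; have hS : (size S <= hmax S)%N.
  by move: m0; rewrite /mpar; move: n0 nS; clear; lia.
have eqS x y : x \in S -> y \in S -> x = y.
  move=> xS yS; apply/eqP/negPn/negP => xy.
  have cnt g : (count_mem g S < size S)%N.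
    rewrite ltn_neqAle count_size andbT -all_count; apply/negP => /allP al.
    by move: xy; rewrite (eqP (al x xS)) (eqP (al y yS)) eqxx.
  have : (hmax S < size S)%N.
    rewrite /hmax; elim/big_ind: _ => // [|i j]; first exact: leq_ltn_trans nS.
    by rewrite gtn_max => -> ->.
  by rewrite ltnNge hS.
case: S nS eqS {m0 hS} => [//|x S] _ eqS.
have -> : supp (x :: S) = [fset x].
  apply/fsetP => g; rewrite mem_supp in_fset1; apply/idP/eqP => [gS|->].
    by apply: eqS => //; apply: mem_head.
  exact: mem_head.
exact: cardfs1.
Qed.

Theorem theorem3p3 (G : zmodType) (n : nat) (S : seq G) :
  (1 <= n)%N -> (n < size S)%N ->
  (#|` Sigma n S| <= (mpar n S).+1)%N ->
  (* Item 5 *)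
  (exists (x : G) (A : 'I_n -> {fset G}),
      (forall i, A i != fset0) /\
      mdivides (seq_of_part A) S /\
      size (seq_of_part A) = (n + mpar n S)%N /\
      bigsumset (enum 'I_n) predT A = Sigma n S /\
      (forall y, y \in mremove (seq_of_part A) S -> in_stab (Sigma n S) (y - x)) /\
      (forall i, (#|` A i| <= 2)%N /\ exists2 a, a \in A i & in_stab (Sigma n S) (a - x)) /\
      (exists j : 'I_n,
          #|` bigsumset (enum 'I_n) predT A| = #|` bigsumset (enum 'I_n) (fun i => i != j) A|) /\
      (exists g : G, g != 0 /\ in_stab (Sigma n S) g))
  \/
  ((#|` Sigma n S| = (mpar n S).+1 \/ #|` supp S| = 1%N) /\
   [\/ (* Item 1 *)
       [/\ n = 2%N, size S = #|` supp S| &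
           exists (x : G) (f : ('Z_2 * 'Z_2)%type -> G),
             [/\ forall a b, f (a + b) = f a + f b, injective f &
                 supp S = [fset (x + f k) | k : ('Z_2 * 'Z_2)%type]]],
       (* Item 2 *)
       mpar n S = 2%N /\
         exists (x : G) (f : 'Z_3 -> G),
           [/\ forall a b, f (a + b) = f a + f b, injective f &
               supp S = [fset (x + f k) | k : 'Z_3]],
       (* Item 3 *)
       (#|` supp S| <= 2)%N |
       (* Item 4 *)
       exists x d : G,
         [/\ supp S `<=` [fset x - d; x; x + d],
             count_mem x S = hmax S &
             (size S - mpar n S <= hmax S)%N]]).
Proof.
move=> n0 nS small; set m := mpar n S in small *.
have mn : (m <= n)%N by apply: geq_minl.
case: (posnP m) => [m0|m0].
  by right; have c1 := mpar0_supp n0 nS m0; split; [right|apply: Or43; rewrite c1].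
pose D (t : seq (G * G) * seq G * seq G) := subsums (diffs t.1.1).
pose dec (t : seq (G * G) * seq G * seq G) := decomp n m S t.1.1 t.1.2 t.2.
pose mx (t : seq (G * G) * seq G * seq G) := dec t /\ maximal n m S t.1.1.
have [t [tdec tmx]] : exists t, mx t.
  have [|t|t [td tm]] := @exists_max _ dec (fun t => #|` D t|) m.+1.
  - by have [ps [bs [ys d]]] := decomp_exists nS; exists (ps, bs, ys).
  - by move=> td; apply: leq_trans (card_decomp_le mn td) small.
  by exists t; split=> // ps bs ys d; apply: (tm (ps, bs, ys)).
pose many t := mx t /\ (#|` stab (D t)| <= inside (stab (D t)) t.1.1)%N.
case: (classic (exists u, many u)) => [exm|nm].
  have [|u [[[ud um] uin] uout]] :=
      @exists_max _ many (fun t => outside (stab (D t)) t.1.1) m exm.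
    move=> u [[[_ _ <- _] _] _]; rewrite -(inside_outside (stab (D u))).
    exact: leq_addl.
  have [] := clustered_decomp mn small ud um uin.
  - by move=> ps bs ys d dm H' din; apply: (uout (ps, bs, ys)).
  - by left.
  - by move=> [c kl]; right; split; [left|apply: Or41].
(* No maximal decomposition has |H| differences in its stabilizer [H], so a redundant one meets the
   hypothesis of [redundant_coset]. *)
case: (classic (exists2 u, mx u & redundant (diffs u.1.1))) => [[u [ud um] ur]|nr].
  left; apply: (redundant_coset n0 nS mn small ud ur).
  by rewrite ltnNge; apply/negP => le; apply: nm; exists u.
(* A decomposition with more than [m] sums is automatically maximal, so [nr] applies to it. *)
have irr ps bs ys : decomp n m S ps bs ys ->
    (m < #|` subsums (diffs ps)|)%N -> ~ redundant (diffs ps).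
  move=> d big r; apply: nr; exists (ps, bs, ys) => //; split=> // ps' bs' ys' d'.
  exact: leq_trans (leq_trans (card_decomp_le mn d') small) big.
have big : (m < #|` D t|)%N.
  have <- : size (diffs t.1.1) = m by rewrite size_map; case: tdec.
  by apply: card_subsums => r; apply: nr; exists t.
right; split.
  left; apply/eqP; rewrite eqn_leq small; apply: leq_trans big _.
  exact: card_decomp_le mn tdec.
by have [z3|c2|ap] := irredundant_shape n0 mn small irr m0 tdec big;
  [apply: Or42|apply: Or43|apply: Or44].
Qed.
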